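(* Let $\phi$ be a smooth real-valued solution of the minimal surface equation $$(1+\phi_y^2)\phi_{xx}-2\phi_x\phi_y\phi_{xy}+(1+\phi_x^2)\phi_{yy}=0$$ on an open subset of $\mathbb{R}^2$, and let $p$ be a point of this open set at which the graph of $\phi$ is not umbilical, i.e. at which $\phi_{zz}\phi_{\bar z\bar z}-\phi_{z\bar z}^2\neq 0$. Put $u=\phi_{\bar z}$, $v=\phi_z=\bar u$ and $$\zeta=\frac{\sqrt{1+4uv}-1}{2v}.$$ Then near $p$ the function $\zeta$ is a complex local coordinate on the graph whose real and imaginary parts $\zeta_1=\Re\zeta$, $\zeta_2=\Im\zeta$ are isothermal coordinates, i.e. the immersion $X=(x,y,\phi)$ satisfies $|X_{\zeta_1}|^2=|X_{\zeta_2}|^2$ and $\langle X_{\zeta_1},X_{\zeta_2}\rangle=0$. Moreover there is a holomorphic function $F$ defined on a disc centred at $\zeta_0=\zeta(p)$ such that, on this disc, the surface is given by $$x(\zeta)=x_0+\Re\int_{\zeta_0}^{\zeta}(1-\omega^2)F'(\omega)\,d\omega,$$ $$y(\zeta)=y_0+\Re\int_{\zeta_0}^{\zeta}i(1+\omega^2)F'(\omega)\,d\omega,$$ $$\phi(\zeta)=\phi_0+\Re\int_{\zeta_0}^{\zeta}2\omega F'(\omega)\,d\omega,$$ where $(x_0,y_0,\phi_0)$ is the point of the graph over $p$.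
   Context: Write $z=x+iy$, $\bar z=x-iy$. Subscripts $z,\bar z$ denote the Wirtinger derivatives $\partial_z=\frac12(\partial_x-i\partial_y)$, $\partial_{\bar z}=\frac12(\partial_x+i\partial_y)$. The surface considered is the graph $\{(x,y,\phi(x,y))\}\subset\mathbb{R}^3$. Since $v=\bar u$, one has $uv=|u|^2\ge 0$ and the square root is the nonnegative one. At points where $u=v=0$ the expression for $\zeta$ is understood as its continuous extension $\zeta=2u/(1+\sqrt{1+4uv})$, i.e. $\zeta=0$. The inverse of the change of variables is $u=\zeta/(1-\zeta\bar\zeta)$, with $|\zeta|<1$. In the formulas for the surface, $x$, $y$ and $\phi$ are regarded as functions of $\zeta$ near $\zeta_0$. *)

(* Defs.v *)
(* Real analysis with Stdlib's R and Coquelicot.  The plane is R * R, which is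
   also the carrier of Coquelicot's complex numbers C, so that the point (a, b)
   of the plane and the complex number a + i b are the same term. *)
From Stdlib Require Import Reals.
From Coquelicot Require Import Coquelicot.

Open Scope R_scope.

Definition pdx (f : R -> R -> R) (x y : R) : R := Derive (fun t => f t y) x.
Definition pdy (f : R -> R -> R) (x y : R) : R := Derive (fun t => f x t) y.

(* C^infinity on D: [ex_diff_n f n] asks for the existence and the continuity
   of all iterated partial derivatives up to order n.  Meant for D open. *)
Definition smooth_on (D : R * R -> Prop) (f : R -> R -> R) : Prop :=
  forall (n : nat) (x y : R), D (x, y) -> ex_diff_n f n x y.

Definition minimal_surface_eq (phi : R -> R -> R) (x y : R) : Prop :=
  (1 + pdy phi x y ^ 2) * pdx (pdx phi) x y
  - 2 * pdx phi x y * pdy phi x y * pdy (pdx phi) x y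
  + (1 + pdx phi x y ^ 2) * pdy (pdy phi) x y = 0.

Definition re_part (f : R -> R -> C) (x y : R) : R := Re (f x y).
Definition im_part (f : R -> R -> C) (x y : R) : R := Im (f x y).

Definition Cpdx (f : R -> R -> C) (x y : R) : C :=
  (pdx (re_part f) x y, pdx (im_part f) x y).
Definition Cpdy (f : R -> R -> C) (x y : R) : C :=
  (pdy (re_part f) x y, pdy (im_part f) x y).

(* Wirtinger derivatives of a complex-valued function of (x, y). *)
Definition d_z (f : R -> R -> C) (x y : R) : C :=
  (/ 2 * (Cpdx f x y - Ci * Cpdy f x y))%C.
Definition d_zbar (f : R -> R -> C) (x y : R) : C :=
  (/ 2 * (Cpdx f x y + Ci * Cpdy f x y))%C.

Definition cplx (f : R -> R -> R) (x y : R) : C := RtoC (f x y).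

Definition non_umbilic (phi : R -> R -> R) (x y : R) : Prop :=
  (d_z (d_z (cplx phi)) x y * d_zbar (d_zbar (cplx phi)) x y
   - d_zbar (d_z (cplx phi)) x y * d_zbar (d_z (cplx phi)) x y)%C <> RtoC 0.

(* zeta = (sqrt (1 + 4 u v) - 1) / (2 v), extended continuously by 0 where
   v = 0.  Since v is the conjugate of u, the number u v is real and
   nonnegative, and the real square root of its real part is the one meant. *)
Definition zeta_of (phi : R -> R -> R) (x y : R) : C :=
  let u := d_zbar (cplx phi) x y in
  let v := d_z (cplx phi) x y in
  if Ceq_dec v (RtoC 0) then RtoC 0
  else ((RtoC (sqrt (1 + 4 * Re (u * v)%C)) - 1) / (2 * v))%C.

(* w is a complex coordinate on V, with image W: a smooth diffeomorphism from
   the open set V onto the open set W of C, whose inverse has the components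
   xs and ys, as functions of the real and imaginary parts of w.  Since (x, y)
   is a global chart of a graph, this is a coordinate on the part of the graph
   over V. *)
Definition is_complex_coordinate (V : R * R -> Prop) (w : R -> R -> C)
    (W : C -> Prop) (xs ys : R -> R -> R) : Prop :=
  open V /\ open W /\
  smooth_on V (re_part w) /\ smooth_on V (im_part w) /\
  smooth_on W xs /\ smooth_on W ys /\
  (forall x y : R, V (x, y) ->
     W (w x y) /\
     xs (Re (w x y)) (Im (w x y)) = x /\ ys (Re (w x y)) (Im (w x y)) = y) /\
  (forall s t : R, W (s, t) ->
     V (xs s t, ys s t) /\ w (xs s t) (ys s t) = (s, t)).

Definition dot3 (a b : R * R * R) : R :=
  let '(a1, a2, a3) := a in
  let '(b1, b2, b3) := b in
  a1 * b1 + a2 * b2 + a3 * b3.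

(* The parameters s, t of the surface X = (X1, X2, X3) are isothermal on W. *)
Definition isothermal_on (W : C -> Prop) (X1 X2 X3 : R -> R -> R) : Prop :=
  forall s t : R, W (s, t) ->
    let Xs := (pdx X1 s t, pdx X2 s t, pdx X3 s t) in
    let Xt := (pdy X1 s t, pdy X2 s t, pdy X3 s t) in
    dot3 Xs Xs = dot3 Xt Xt /\ dot3 Xs Xt = 0.

Definition cdisc (c : C) (r : R) (w : C) : Prop := Cmod (w - c)%C < r.

Definition holomorphic_on (D : C -> Prop) (F : C -> C) : Prop :=
  forall w : C, D w -> ex_derive (K := C_AbsRing) (V := C_NormedModule) F w.

(* The complex integral of g from a to b, along the segment [a, b].  For g
   holomorphic on a disc containing a and b it does not depend on the path. *)
Definition cint (g : C -> C) (a b : C) : C :=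
  RInt (V := C_R_CompleteNormedModule)
    (fun t : R => (g (a + RtoC t * (b - a)) * (b - a))%C) 0 1.

(* Main.v *)
Require Import Defs.
From Stdlib Require Import Reals Lra Lia Psatz ClassicalEpsilon.
From Coquelicot Require Import Coquelicot.

(** Up to a smooth change of variables, [zeta] is the gradient of [phi]: if
    [grad phi = (p, q)], then [zeta = (p + i q) / (1 + sqrt (1 + p^2 + q^2))],
    which maps the plane diffeomorphically onto the unit disc, with inverse
    [p + i q = 2 zeta / (1 - |zeta|^2)] ([zeta_of_gradient], [grad_gauss],
    [gauss_grad]).  At a non-umbilical point the Hessian of [phi] is invertible
    ([non_umbilic_hessian]), so the inverse function theorem, obtained from the
    contraction principle ([inverse_function]), makes [zeta] a coordinate near
    that point ([gauss_coordinate]).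

    In this coordinate, [grad phi (x, y)] is an explicit function of [zeta], and
    differentiating that identity expresses the derivatives of [x] and [y]
    linearly through the cofactors of the Hessian.  The Hessian satisfies one
    linear relation, the minimal surface equation, and this relation says
    exactly that, with [h] the [zeta]-derivative of [x - i y],
    [dx = Re ((1 - zeta^2) h dzeta)] and [dy = Re (i (1 + zeta^2) h dzeta)]
    ([minimal_weierstrass_form]); then also [d phi = Re (2 zeta h dzeta)]
    ([height_differentiable]).  The isothermal relations follow at once.

    It remains to see that [h] is holomorphic.  Let [k] be its derivative with
    respect to the conjugate of [zeta].  Since [x] and [y] are real and mixed
    derivatives commute, [(1 - zeta^2) k] and [i (1 + zeta^2) k] are both real,
    which in the unit disc is possible only for [k = 0]
    ([weierstrass_holomorphic]).  By the Poincare lemma [h] has a primitive [F]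
    on a square about [zeta0], and integrating the three differentials along radii gives the
    formulas ([weierstrass_integrals]). *)

Open Scope R_scope.

(** * Finitely differentiable functions on an open set *)

Definition Ck (k : nat) (D : R * R -> Prop) (f : R -> R -> R) : Prop :=
  forall x y, D (x, y) -> ex_diff_n f k x y.

Lemma open_locally_2d (D : R * R -> Prop) x y :
  open D -> D (x, y) -> locally_2d (fun u v => D (u, v)) x y.
Proof.
  intros oD Dxy. apply locally_2d_locally.
  apply (filter_imp D); [now intros [u v] | exact (oD _ Dxy)].
Qed.

Lemma locally_2d_open (D : R * R -> Prop) :
  (forall x y, D (x, y) -> locally_2d (fun u v => D (u, v)) x y) -> open D.
Proof.
  intros H [x y] Dxy.
  generalize (proj1 (locally_2d_locally _ _ _) (H x y Dxy)).
  apply filter_imp. now intros [u v].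
Qed.

Lemma Ck_le j k D f : (j <= k)%nat -> Ck k D f -> Ck j D f.
Proof. intros jk H x y Dxy. apply (ex_diff_n_m k j jk), H, Dxy. Qed.

Lemma Ck_sub k (D D' : R * R -> Prop) f :
  (forall q, D q -> D' q) -> Ck k D' f -> Ck k D f.
Proof. intros DD' H x y Dxy. apply H, DD', Dxy. Qed.

Lemma Ck_ext k D f g :
  open D -> (forall x y, D (x, y) -> f x y = g x y) -> Ck k D f -> Ck k D g.
Proof.
  intros oD fg H x y Dxy. apply ex_diff_n_ext_loc with f; [|now apply H].
  destruct (open_locally_2d D x y oD Dxy) as [d Hd].
  exists d; intros u v Hu Hv; apply fg, Hd; assumption.
Qed.

Lemma Ck_continuous k D f x y : Ck k D f -> D (x, y) -> continuity_2d_pt f x y.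
Proof. intros H Dxy. specialize (H x y Dxy). destruct k; apply H. Qed.

Lemma differentiable_is_derive_x f x y a b :
  differentiable_pt_lim f x y a b -> is_derive (fun t => f t y) x a.
Proof.
  intros H. apply is_derive_Reals.
  replace a with (a * 1 + b * 0) by ring.
  apply (derivable_pt_lim_comp_2d f (fun t => t) (fun _ => y)); auto.
  apply derivable_pt_lim_id. apply derivable_pt_lim_const.
Qed.

Lemma differentiable_is_derive_y f x y a b :
  differentiable_pt_lim f x y a b -> is_derive (fun t => f x t) y b.
Proof.
  intros H. apply is_derive_Reals.
  replace b with (a * 0 + b * 1) by ring.
  apply (derivable_pt_lim_comp_2d f (fun _ => x) (fun t => t)); auto.
  apply derivable_pt_lim_const. apply derivable_pt_lim_id.
Qed.

Lemma differentiable_pd f x y a b :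
  differentiable_pt_lim f x y a b -> pdx f x y = a /\ pdy f x y = b.
Proof. apply differentiable_pt_lim_unique. Qed.

(** Smoothness is always obtained by induction on the order through this
    lemma: the gradient of a sum, quotient, composite or inverse is given by a
    formula in functions already known to be of class [C^k]. *)
Lemma Ck_S_intro k D f fx fy :
  open D ->
  (forall x y, D (x, y) -> differentiable_pt_lim f x y (fx x y) (fy x y)) ->
  Ck k D fx -> Ck k D fy -> Ck (S k) D f.
Proof.
  intros oD Hf Hx Hy x y Dxy.
  assert (Hxy := Hf x y Dxy).
  assert (cf : continuity_2d_pt f x y).
  { apply differentiable_continuity_pt. now exists (fx x y), (fy x y). }
  split; [exact cf|]. repeat split.
  - eexists. now apply differentiable_is_derive_x with (1 := Hxy).
  - eexists. now apply differentiable_is_derive_y with (1 := Hxy).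
  - apply (Ck_ext k D fx); auto.
    intros u v Duv. symmetry. apply (differentiable_pd _ _ _ _ _ (Hf u v Duv)).
  - apply (Ck_ext k D fy); auto.
    intros u v Duv. symmetry. apply (differentiable_pd _ _ _ _ _ (Hf u v Duv)).
Qed.

Lemma Ck_pdx k D f : Ck (S k) D f -> Ck k D (pdx f).
Proof. intros H x y Dxy. apply (ex_diff_n_deriv_aux1 _ _ _ _ (H x y Dxy)). Qed.

Lemma Ck_pdy k D f : Ck (S k) D f -> Ck k D (pdy f).
Proof. intros H x y Dxy. apply (ex_diff_n_deriv_aux2 _ _ _ _ (H x y Dxy)). Qed.

Lemma Ck_differentiable k D f x y :
  open D -> Ck (S k) D f -> D (x, y) ->
  differentiable_pt_lim f x y (pdx f x y) (pdy f x y).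
Proof.
  intros oD H Dxy.
  apply filterdiff_differentiable_pt_lim.
  apply (is_derive_filterdiff f x y (pdx f)).
  - apply (filter_imp D); [|exact (oD _ Dxy)].
    intros [u v] Duv. apply Derive_correct. apply (H u v Duv).
  - apply Derive_correct, (H x y Dxy).
  - apply continuity_2d_pt_filterlim.
    apply (Ck_continuous k D); auto. now apply Ck_pdx.
Qed.

Lemma Ck_pd_comm D f x y :
  open D -> Ck 2 D f -> D (x, y) -> pdx (pdy f) x y = pdy (pdx f) x y.
Proof.
  intros oD H Dxy. apply Schwarz.
  - destruct (open_locally_2d D x y oD Dxy) as [d Hd].
    exists d. intros u v Hu Hv. pose proof (Hd _ _ Hu Hv) as Duv.
    repeat split; try apply (H u v Duv).
  - apply (Ck_continuous 0 D (pdx (pdy f))); auto. now apply Ck_pdx, Ck_pdy.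
  - apply (Ck_continuous 0 D (pdy (pdx f))); auto. now apply Ck_pdy, Ck_pdx.
Qed.

Lemma Ck_const k D c : Ck k D (fun _ _ => c).
Proof.
  revert c. induction k as [|k IH]; intros c x y Dxy.
  - split; auto. apply continuity_2d_pt_const.
  - split; [apply continuity_2d_pt_const|].
    split; [apply ex_derive_const|]. split; [apply ex_derive_const|].
    split; [apply ex_diff_n_ext_loc with (fun _ _ => 0)|
            apply ex_diff_n_ext_loc with (fun _ _ => 0)];
      try (apply locally_2d_forall; intros; now rewrite Derive_const);
      now apply IH.
Qed.

Lemma differentiable_of_is_derive_x f x y a :
  is_derive f x a -> differentiable_pt_lim (fun u _ => f u) x y a 0.
Proof. intros H. apply differentiable_pt_lim_proj1_0, is_derive_Reals, H. Qed.

Lemma differentiable_id1 x y : differentiable_pt_lim (fun u _ => u) x y 1 0.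
Proof. apply (differentiable_of_is_derive_x (fun u => u)). apply @is_derive_id. Qed.

Lemma differentiable_id2 x y : differentiable_pt_lim (fun _ v => v) x y 0 1.
Proof.
  intros eps. exists (mkposreal 1 Rlt_0_1). intros u v _ _.
  replace (v - y - (0 * (u - x) + 1 * (v - y))) with 0 by ring.
  rewrite Rabs_R0. apply Rmult_le_pos; [apply Rlt_le, cond_pos|].
  apply Rle_trans with (2 := Rmax_l _ _). apply Rabs_pos.
Qed.

Lemma Ck_id1 k D : open D -> Ck k D (fun u _ => u).
Proof.
  intros oD. apply (Ck_le k (S k)); [lia|].
  apply (Ck_S_intro k D _ (fun _ _ => 1) (fun _ _ => 0)); auto using Ck_const.
  intros; apply differentiable_id1.
Qed.

Lemma Ck_id2 k D : open D -> Ck k D (fun _ v => v).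
Proof.
  intros oD. apply (Ck_le k (S k)); [lia|].
  apply (Ck_S_intro k D _ (fun _ _ => 0) (fun _ _ => 1)); auto using Ck_const.
  intros; apply differentiable_id2.
Qed.

Lemma differentiable_plus f g x y a b a' b' :
  differentiable_pt_lim f x y a b -> differentiable_pt_lim g x y a' b' ->
  differentiable_pt_lim (fun u v => f u v + g u v) x y (a + a') (b + b').
Proof.
  intros Hf Hg.
  replace (a + a') with (1 * a + 1 * a') by ring.
  replace (b + b') with (1 * b + 1 * b') by ring.
  apply (differentiable_pt_lim_comp (fun p q => p + q) f g); auto.
  intros eps. exists (mkposreal 1 Rlt_0_1). intros u v _ _.
  match goal with |- Rabs ?e <= _ => replace e with 0 by ring end.
  rewrite Rabs_R0. apply Rmult_le_pos; [apply Rlt_le, cond_pos|].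
  apply Rle_trans with (2 := Rmax_l _ _). apply Rabs_pos.
Qed.

Lemma differentiable_mult f g x y a b a' b' :
  differentiable_pt_lim f x y a b -> differentiable_pt_lim g x y a' b' ->
  differentiable_pt_lim (fun u v => f u v * g u v) x y
    (a * g x y + f x y * a') (b * g x y + f x y * b').
Proof.
  intros Hf Hg.
  replace (a * g x y) with (g x y * a) by ring.
  replace (b * g x y) with (g x y * b) by ring.
  apply (differentiable_pt_lim_comp (fun p q => p * q) f g); auto.
  intros eps. exists eps. intros u v Hu Hv.
  match goal with |- Rabs ?e <= _ =>
    replace e with ((u - f x y) * (v - g x y)) by ring end.
  rewrite Rabs_mult. apply Rmult_le_compat; try apply Rabs_pos.
  - now apply Rlt_le. - apply Rmax_r.
Qed.

Lemma differentiable_comp1 (h : R -> R) f x y l a b :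
  is_derive h (f x y) l -> differentiable_pt_lim f x y a b ->
  differentiable_pt_lim (fun u v => h (f u v)) x y (l * a) (l * b).
Proof.
  intros Hh Hf.
  replace (l * a) with (l * a + 0 * 0) by ring.
  replace (l * b) with (l * b + 0 * 1) by ring.
  apply (differentiable_pt_lim_comp (fun p _ => h p) f (fun _ v => v)); auto.
  - now apply differentiable_of_is_derive_x.
  - apply differentiable_id2.
Qed.

Lemma Ck_plus k D f g : open D -> Ck k D f -> Ck k D g ->
  Ck k D (fun x y => f x y + g x y).
Proof.
  intros oD. revert f g. induction k as [|k IH]; intros f g Hf Hg.
  - intros x y Dxy. split; auto.
    apply continuity_2d_pt_plus; eauto using Ck_continuous.
  - apply (Ck_S_intro k D _ (fun x y => pdx f x y + pdx g x y)
                            (fun x y => pdy f x y + pdy g x y)); auto using Ck_pdx, Ck_pdy.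
    intros x y Dxy. apply differentiable_plus; eauto using Ck_differentiable.
Qed.

Lemma Ck_mult k D f g : open D -> Ck k D f -> Ck k D g ->
  Ck k D (fun x y => f x y * g x y).
Proof.
  intros oD. revert f g. induction k as [|k IH]; intros f g Hf Hg.
  - intros x y Dxy. split; auto.
    apply continuity_2d_pt_mult; eauto using Ck_continuous.
  - assert (Hf' : Ck k D f) by (apply (Ck_le k (S k)); [lia|auto]).
    assert (Hg' : Ck k D g) by (apply (Ck_le k (S k)); [lia|auto]).
    apply (Ck_S_intro k D _ (fun x y => pdx f x y * g x y + f x y * pdx g x y)
                            (fun x y => pdy f x y * g x y + f x y * pdy g x y));
      auto using Ck_pdx, Ck_pdy, Ck_plus.
    intros x y Dxy. apply differentiable_mult; eauto using Ck_differentiable.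
Qed.

Lemma Ck_opp k D f : open D -> Ck k D f -> Ck k D (fun x y => - f x y).
Proof.
  intros oD Hf. apply (Ck_ext k D (fun x y => (-1) * f x y)); auto.
  - intros; ring.
  - apply Ck_mult; auto using Ck_const.
Qed.

Lemma Ck_minus k D f g : open D -> Ck k D f -> Ck k D g ->
  Ck k D (fun x y => f x y - g x y).
Proof. intros. apply Ck_plus; auto using Ck_opp. Qed.

Lemma Ck_inv k D f : open D -> (forall x y, D (x, y) -> f x y <> 0) ->
  Ck k D f -> Ck k D (fun x y => / f x y).
Proof.
  intros oD f0. induction k as [|k IH]; intros Hf.
  - intros x y Dxy. split; auto.
    apply continuity_2d_pt_inv; eauto using Ck_continuous.
  - assert (Hi : Ck k D (fun x y => / f x y)).
    { apply IH, (Ck_le k (S k)); [lia|auto]. }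
    assert (Hi2 : Ck k D (fun x y => - (/ f x y * / f x y)))
      by auto using Ck_mult, Ck_opp.
    apply (Ck_S_intro k D _ (fun x y => - (/ f x y * / f x y) * pdx f x y)
                            (fun x y => - (/ f x y * / f x y) * pdy f x y));
      auto using Ck_mult, Ck_pdx, Ck_pdy.
    intros x y Dxy. apply (differentiable_comp1 Rinv).
    + replace (- (/ f x y * / f x y)) with (- 1 / (f x y) ^ 2)
        by (field; auto).
      apply (is_derive_inv (fun t => t)); auto. apply @is_derive_id.
    + eauto using Ck_differentiable.
Qed.

Lemma Ck_sqrt k D f : open D -> (forall x y, D (x, y) -> 0 < f x y) ->
  Ck k D f -> Ck k D (fun x y => sqrt (f x y)).
Proof.
  intros oD f0. induction k as [|k IH]; intros Hf.
  - intros x y Dxy. split; auto.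
    apply continuity_1d_2d_pt_comp; eauto using Ck_continuous.
    apply continuity_pt_sqrt, Rlt_le, f0, Dxy.
  - assert (s0 : forall x y, D (x, y) -> 0 < sqrt (f x y)).
    { intros; now apply sqrt_lt_R0, f0. }
    assert (Hi : Ck k D (fun x y => / (2 * sqrt (f x y)))).
    { apply Ck_inv; auto.
      - intros x y Dxy. specialize (s0 x y Dxy). lra.
      - apply Ck_mult; auto using Ck_const. apply IH, (Ck_le k (S k)); [lia|auto]. }
    apply (Ck_S_intro k D _ (fun x y => / (2 * sqrt (f x y)) * pdx f x y)
                            (fun x y => / (2 * sqrt (f x y)) * pdy f x y));
      auto using Ck_mult, Ck_pdx, Ck_pdy.
    intros x y Dxy. apply (differentiable_comp1 sqrt).
    + replace (/ (2 * sqrt (f x y))) with (1 / (2 * sqrt (f x y)))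
        by (unfold Rdiv; ring).
      apply (is_derive_sqrt (fun t => t)); auto. apply @is_derive_id.
    + eauto using Ck_differentiable.
Qed.

Lemma continuity_2d_comp f g1 g2 x y :
  continuity_2d_pt f (g1 x y) (g2 x y) ->
  continuity_2d_pt g1 x y -> continuity_2d_pt g2 x y ->
  continuity_2d_pt (fun u v => f (g1 u v) (g2 u v)) x y.
Proof.
  intros Hf H1 H2 eps. destruct (Hf eps) as [d Hd].
  apply locally_2d_impl with (2 := locally_2d_and _ _ _ _ (H1 d) (H2 d)).
  apply locally_2d_forall. intros u v [Hu Hv]. now apply Hd.
Qed.

Lemma Ck_comp k (D E : R * R -> Prop) f g1 g2 :
  open D -> open E -> (forall x y, D (x, y) -> E (g1 x y, g2 x y)) ->
  Ck k E f -> Ck k D g1 -> Ck k D g2 ->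
  Ck k D (fun x y => f (g1 x y) (g2 x y)).
Proof.
  intros oD oE DE. revert f. induction k as [|k IH]; intros f Hf H1 H2.
  - intros x y Dxy. split; auto.
    apply continuity_2d_comp; eauto using Ck_continuous.
  - assert (H1' : Ck k D g1) by (apply (Ck_le k (S k)); [lia|auto]).
    assert (H2' : Ck k D g2) by (apply (Ck_le k (S k)); [lia|auto]).
    apply (Ck_S_intro k D _
      (fun x y => pdx f (g1 x y) (g2 x y) * pdx g1 x y
                + pdy f (g1 x y) (g2 x y) * pdx g2 x y)
      (fun x y => pdx f (g1 x y) (g2 x y) * pdy g1 x y
                + pdy f (g1 x y) (g2 x y) * pdy g2 x y)); auto.
    + intros x y Dxy. apply differentiable_pt_lim_comp; eauto using Ck_differentiable.
    + apply Ck_plus; auto; apply Ck_mult; auto using Ck_pdx, Ck_pdy.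
    + apply Ck_plus; auto; apply Ck_mult; auto using Ck_pdx, Ck_pdy.
Qed.

(** * The inverse function theorem in the plane *)

Definition square (x0 y0 r : R) (q : R * R) : Prop :=
  Rabs (fst q - x0) < r /\ Rabs (snd q - y0) < r.

Lemma open_preimage (D E : R * R -> Prop) g1 g2 :
  open D -> open E -> Ck 0 D g1 -> Ck 0 D g2 ->
  open (fun q => D q /\ E (g1 (fst q) (snd q), g2 (fst q) (snd q))).
Proof.
  intros oD oE H1 H2. apply locally_2d_open. simpl. intros x y [Dxy Exy].
  apply locally_2d_and; [now apply open_locally_2d|].
  destruct (open_locally_2d E _ _ oE Exy) as [d Hd].
  generalize (locally_2d_and _ _ _ _
    (Ck_continuous 0 D g1 x y H1 Dxy d) (Ck_continuous 0 D g2 x y H2 Dxy d)).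
  intros [d' Hd']. exists d'. intros u v Hu Hv. apply Hd; apply (Hd' u v Hu Hv).
Qed.

Lemma open_square x0 y0 r : open (square x0 y0 r).
Proof.
  apply locally_2d_open. intros x y [Hx Hy]; simpl in *.
  assert (d0 : 0 < Rmin (r - Rabs (x - x0)) (r - Rabs (y - y0)))
    by (apply Rmin_pos; lra).
  exists (mkposreal _ d0). intros u v Hu Hv; simpl in *.
  assert (m1 := Rmin_l (r - Rabs (x - x0)) (r - Rabs (y - y0))).
  assert (m2 := Rmin_r (r - Rabs (x - x0)) (r - Rabs (y - y0))).
  split; simpl.
  - replace (u - x0) with ((u - x) + (x - x0)) by ring.
    apply Rle_lt_trans with (1 := Rabs_triang _ _). lra.
  - replace (v - y0) with ((v - y) + (y - y0)) by ring.
    apply Rle_lt_trans with (1 := Rabs_triang _ _). lra.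
Qed.

Lemma interval_between x0 r u u' t :
  Rabs (u - x0) < r -> Rabs (u' - x0) < r -> Rmin u u' <= t <= Rmax u u' ->
  Rabs (t - x0) < r.
Proof.
  intros H H' [t1 t2]. apply Rabs_def2 in H. apply Rabs_def2 in H'.
  assert (x0 - r < Rmin u u') by (apply Rmin_glb_lt; lra).
  assert (Rmax u u' < x0 + r) by (apply Rmax_lub_lt; lra).
  apply Rabs_def1; lra.
Qed.

Lemma mean_value f f' u u' M :
  (forall t, Rmin u u' <= t <= Rmax u u' -> is_derive f t (f' t)) ->
  (forall t, Rmin u u' <= t <= Rmax u u' -> Rabs (f' t) <= M) ->
  Rabs (f u' - f u) <= M * Rabs (u' - u).
Proof.
  intros Hf HM. destruct (MVT_gen f u u' f') as [c [Hc E]].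
  - intros t Ht. apply Hf; lra.
  - intros t Ht. apply continuity_pt_filterlim.
    apply (ex_derive_continuous f). eexists; now apply Hf.
  - rewrite E, Rabs_mult. apply Rmult_le_compat_r; [apply Rabs_pos|auto].
Qed.

Lemma mean_value_square f fx fy x0 y0 r M :
  (forall x y, square x0 y0 r (x, y) ->
     differentiable_pt_lim f x y (fx x y) (fy x y)) ->
  (forall x y, square x0 y0 r (x, y) -> Rabs (fx x y) <= M /\ Rabs (fy x y) <= M) ->
  forall x y x' y', square x0 y0 r (x, y) -> square x0 y0 r (x', y') ->
  Rabs (f x' y' - f x y) <= M * (Rabs (x' - x) + Rabs (y' - y)).
Proof.
  intros Hf HM x y x' y' [Hx Hy] [Hx' Hy']; simpl in *.
  replace (f x' y' - f x y) with ((f x' y' - f x y') + (f x y' - f x y)) by ring.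
  apply Rle_trans with (1 := Rabs_triang _ _). rewrite Rmult_plus_distr_l.
  apply Rplus_le_compat.
  - apply (mean_value (fun t => f t y') (fun t => fx t y')); intros t Ht;
      assert (St : square x0 y0 r (t, y'))
        by (split; simpl; auto; now apply (interval_between x0 r x x')).
    + now apply differentiable_is_derive_x with (1 := Hf _ _ St).
    + now apply HM.
  - apply (mean_value (fun t => f x t) (fun t => fy x t)); intros t Ht;
      assert (St : square x0 y0 r (x, t))
        by (split; simpl; auto; now apply (interval_between y0 r y y')).
    + now apply differentiable_is_derive_y with (1 := Hf _ _ St).
    + now apply HM.
Qed.

Definition dist1 (p q : R * R) : R :=
  Rabs (fst p - fst q) + Rabs (snd p - snd q).

Lemma dist1_triangle p q s : dist1 p s <= dist1 p q + dist1 q s.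
Proof.
  unfold dist1.
  assert (H1 := Rabs_triang (fst p - fst q) (fst q - fst s)).
  assert (H2 := Rabs_triang (snd p - snd q) (snd q - snd s)).
  replace (fst p - fst q + (fst q - fst s)) with (fst p - fst s) in H1 by ring.
  replace (snd p - snd q + (snd q - snd s)) with (snd p - snd s) in H2 by ring.
  lra.
Qed.

Lemma dist1_le_square x0 y0 r q : dist1 q (x0, y0) < r -> square x0 y0 r q.
Proof.
  unfold dist1; simpl. intros H.
  assert (H1 := Rabs_pos (fst q - x0)). assert (H2 := Rabs_pos (snd q - y0)).
  split; lra.
Qed.

Lemma pow_half_small c : 0 < c -> forall eps, 0 < eps ->
  exists n, forall k, (n <= k)%nat -> c * (1 / 2) ^ k < eps.
Proof.
  intros c0 eps e0.
  assert (q0 : 0 < eps / c) by (apply Rdiv_lt_0_compat; auto).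
  destruct (pow_lt_1_zero (1 / 2)) with (y := eps / c) as [n Hn]; auto.
  { rewrite Rabs_right; lra. }
  exists n. intros k nk. specialize (Hn k nk).
  assert (p0 : 0 < (1 / 2) ^ k) by (apply pow_lt; lra).
  rewrite Rabs_right in Hn by lra.
  apply Rmult_lt_compat_l with (r := c) in Hn; auto.
  replace (c * (eps / c)) with eps in Hn by (field; lra). exact Hn.
Qed.

Lemma dist1_cauchy (z : nat -> R * R) c :
  0 < c -> (forall n k, dist1 (z (n + k)%nat) (z n) <= c * (1 / 2) ^ n) ->
  exists l, forall n, dist1 l (z n) <= c * (1 / 2) ^ n.
Proof.
  intros c0 Hz.
  assert (cv : forall pr : R * R -> R,
    (forall p q, Rabs (pr p - pr q) <= dist1 p q) ->
    exists l, is_lim_seq (fun n => pr (z n)) (Finite l)).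
  { intros pr Hpr.
    assert (cauchy : Cauchy_crit (fun n => pr (z n))).
    { intros eps e0. destruct (pow_half_small c c0 (eps / 2)) as [n Hn]; [lra|].
      exists n. intros i j Hi Hj. unfold Rdist.
      assert (A : forall m, (n <= m)%nat -> Rabs (pr (z m) - pr (z n)) < eps / 2).
      { intros m Hm. replace m with (n + (m - n))%nat by lia.
        apply Rle_lt_trans with (1 := Hpr _ _).
        apply Rle_lt_trans with (1 := Hz _ _). now apply Hn. }
      replace (pr (z i) - pr (z j))
        with ((pr (z i) - pr (z n)) - (pr (z j) - pr (z n))) by ring.
      apply Rle_lt_trans with (1 := Rabs_triang _ _). rewrite Rabs_Ropp.
      generalize (A i Hi) (A j Hj). lra. }
    destruct (Rcomplete.R_complete _ cauchy) as [l Hl]. exists l. now apply is_lim_seq_Reals. }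
  destruct (cv fst) as [l1 H1].
  { intros p q. unfold dist1. generalize (Rabs_pos (snd p - snd q)); lra. }
  destruct (cv snd) as [l2 H2].
  { intros p q. unfold dist1. generalize (Rabs_pos (fst p - fst q)); lra. }
  exists (l1, l2). intros n.
  apply (is_lim_seq_le (fun k => dist1 (z (n + k)%nat) (z n))
           (fun _ => c * (1 / 2) ^ n)
           (Finite (dist1 (l1, l2) (z n))) (Finite (c * (1 / 2) ^ n))).
  - intros k. apply Hz.
  - unfold dist1. apply (is_lim_seq_plus' _ _ (Rabs (l1 - fst (z n))) (Rabs (l2 - snd (z n)))).
    + apply (is_lim_seq_abs _ (Finite (l1 - fst (z n)))).
      apply (is_lim_seq_minus' _ _ l1 (fst (z n))); [|apply is_lim_seq_const].
      apply (is_lim_seq_ext (fun k => fst (z (k + n)%nat))).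
      * intros k. now rewrite PeanoNat.Nat.add_comm.
      * now apply (is_lim_seq_incr_n (fun n => fst (z n))).
    + apply (is_lim_seq_abs _ (Finite (l2 - snd (z n)))).
      apply (is_lim_seq_minus' _ _ l2 (snd (z n))); [|apply is_lim_seq_const].
      apply (is_lim_seq_ext (fun k => snd (z (k + n)%nat))).
      * intros k. now rewrite PeanoNat.Nat.add_comm.
      * now apply (is_lim_seq_incr_n (fun n => snd (z n))).
  - apply is_lim_seq_const.
Qed.

(** Banach's fixed point theorem: the iterates of the centre stay in the
    square because the geometric series of the steps sums to twice the first
    one. *)
Lemma contraction_fixed_point (g : R * R -> R * R) x0 y0 r :
  (forall p q, square x0 y0 r p -> square x0 y0 r q ->
     dist1 (g p) (g q) <= 1 / 2 * dist1 p q) ->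
  dist1 (g (x0, y0)) (x0, y0) < r / 2 ->
  exists p, square x0 y0 r p /\ g p = p.
Proof.
  intros Hg H0. set (c := dist1 (g (x0, y0)) (x0, y0)) in *.
  assert (c0 : 0 <= c).
  { unfold c, dist1. apply Rplus_le_le_0_compat; apply Rabs_pos. }
  (* c may vanish, so a positive bound strictly between 2 c and r is used *)
  set (C := (2 * c + r) / 2).
  set (z := fun n => Nat.iter n g (x0, y0)).
  assert (zin : forall n, dist1 (z n) (x0, y0) <= 2 * c).
  { induction n as [|n IH].
    - unfold z, dist1; simpl. rewrite !Rminus_diag, Rabs_R0; lra.
    - apply Rle_trans with (1 := dist1_triangle _ (g (x0, y0)) _). fold c.
      change (z (S n)) with (g (z n)).
      assert (dist1 (g (z n)) (g (x0, y0)) <= 1 / 2 * dist1 (z n) (x0, y0)).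
      { apply Hg; apply dist1_le_square; [lra|].
        unfold dist1; simpl. rewrite !Rminus_diag, Rabs_R0; lra. }
      lra. }
  assert (zsq : forall n, square x0 y0 r (z n)).
  { intros n. apply dist1_le_square. specialize (zin n). lra. }
  destruct (dist1_cauchy z C) as [l Hl].
  - unfold C; lra.
  - induction n as [|n IH]; intros k.
    + simpl. change (z 0%nat) with (x0, y0). specialize (zin k). unfold C; lra.
    + change (z (S n + k)%nat) with (g (z (n + k)%nat)).
      change (z (S n)) with (g (z n)).
      apply Rle_trans with (1 := Hg _ _ (zsq _) (zsq _)). simpl.
      specialize (IH k). lra.
  - assert (lsq : square x0 y0 r l).
    { apply dist1_le_square. specialize (Hl 0%nat). simpl in Hl.
      change (z 0%nat) with (x0, y0) in Hl. unfold C in Hl; lra. }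
    exists l. split; auto.
    assert (E : dist1 (g l) l <= 0).
    { apply le_epsilon. intros eps e0.
      destruct (pow_half_small C) with (eps := eps) as [n Hn]; [unfold C; lra|auto|].
      specialize (Hn n (le_n n)).
      apply Rle_trans with (1 := dist1_triangle _ (z (S n)) _).
      assert (A : dist1 (g l) (z (S n)) <= 1 / 2 * dist1 l (z n))
        by (apply Hg; auto).
      assert (B0 := Hl (S n)). assert (B' := Hl n). rewrite <- tech_pow_Rmult in B0.
      assert (Sy : dist1 (z (S n)) l = dist1 l (z (S n))).
      { unfold dist1. f_equal; apply Rabs_minus_sym. }
      lra. }
    unfold dist1 in E.
    assert (E1 := Rabs_pos (fst (g l) - fst l)).
    assert (E2 := Rabs_pos (snd (g l) - snd l)).
    assert (F1 : Rabs (fst (g l) - fst l) = 0) by lra.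
    assert (F2 : Rabs (snd (g l) - snd l) = 0) by lra.
    apply Rabs_eq_0 in F1. apply Rabs_eq_0 in F2.
    apply injective_projections; lra.
Qed.

(** A Lipschitz local inverse is differentiable: solving the first order
    expansions of [f1] and [f2] for the increments of [X] and [Y] by Cramer's
    rule leaves an error that the Lipschitz bound makes negligible. *)
Lemma inverse_differentiable f1 f2 X Y s t a b c d K :
  differentiable_pt_lim f1 (X s t) (Y s t) a b ->
  differentiable_pt_lim f2 (X s t) (Y s t) c d ->
  a * d - b * c <> 0 ->
  locally_2d (fun s' t' => f1 (X s' t') (Y s' t') = s' /\
                           f2 (X s' t') (Y s' t') = t') s t ->
  0 < K ->
  locally_2d (fun s' t' =>
    Rabs (X s' t' - X s t) + Rabs (Y s' t' - Y s t)
      <= K * (Rabs (s' - s) + Rabs (t' - t))) s t ->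
  differentiable_pt_lim X s t (d / (a * d - b * c)) (- b / (a * d - b * c)) /\
  differentiable_pt_lim Y s t (- c / (a * d - b * c)) (a / (a * d - b * c)).
Proof.
  intros H1 H2 J0 Hinv K0 HK. set (J := a * d - b * c) in *.
  assert (main : forall eps : posreal, locally_2d (fun s' t' =>
    Rabs (X s' t' - X s t - (d / J * (s' - s) + - b / J * (t' - t)))
      <= eps * Rmax (Rabs (s' - s)) (Rabs (t' - t)) /\
    Rabs (Y s' t' - Y s t - (- c / J * (s' - s) + a / J * (t' - t)))
      <= eps * Rmax (Rabs (s' - s)) (Rabs (t' - t))) s t).
  2:{ split; intros eps; destruct (main eps) as [dl Hdl]; exists dl;
      intros u v Hu Hv; now apply Hdl. }
  intros eps.
  set (T := Rabs a + Rabs b + Rabs c + Rabs d + 1).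
  assert (pa := Rabs_pos a). assert (pb := Rabs_pos b).
  assert (pc := Rabs_pos c). assert (pd := Rabs_pos d).
  assert (T0 : 0 < T) by (unfold T; lra).
  assert (Ja : 0 < Rabs J) by now apply Rabs_pos_lt.
  assert (e0 : 0 < eps * Rabs J / (T * (2 * K))).
  { apply Rdiv_lt_0_compat; apply Rmult_lt_0_compat; auto; [apply cond_pos|lra]. }
  (* the precision that, after the loss of a factor 2 K from the Lipschitz bound
     and of T / |J| from Cramer's rule, still leaves eps *)
  set (e := mkposreal _ e0).
  destruct (locally_2d_and _ _ _ _ (H1 e) (H2 e)) as [d1 Hd1].
  destruct (locally_2d_and _ _ _ _ Hinv HK) as [d2 Hd2].
  assert (d0 : 0 < Rmin d2 (d1 / (2 * K))).
  { apply Rmin_pos; [apply cond_pos|]. apply Rdiv_lt_0_compat; [apply cond_pos|lra]. }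
  exists (mkposreal _ d0). intros s' t' Hs Ht; simpl in Hs, Ht.
  set (M := Rmax (Rabs (s' - s)) (Rabs (t' - t))).
  assert (M1 : Rabs (s' - s) <= M) by apply Rmax_l.
  assert (M2 : Rabs (t' - t) <= M) by apply Rmax_r.
  assert (Md : M < Rmin d2 (d1 / (2 * K))) by now apply Rmax_lub_lt.
  assert (Md2 : M < d2) by (apply Rlt_le_trans with (1 := Md); apply Rmin_l).
  assert (Md1 : 2 * K * M < d1).
  { assert (A : M < d1 / (2 * K))
      by (apply Rlt_le_trans with (1 := Md); apply Rmin_r).
    apply Rmult_lt_compat_l with (r := 2 * K) in A; [|lra].
    replace (2 * K * (d1 / (2 * K))) with (pos d1) in A by (field; lra). exact A. }
  destruct (Hd2 s' t') as [[I1 I2] L]; try lra.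
  set (dX := X s' t' - X s t) in *. set (dY := Y s' t' - Y s t) in *.
  assert (L' : Rabs dX + Rabs dY <= 2 * K * M).
  { apply Rle_trans with (1 := L). replace (2 * K * M) with (K * (M + M)) by ring.
    apply Rmult_le_compat_l; lra. }
  assert (pX := Rabs_pos dX). assert (pY := Rabs_pos dY).
  destruct (Hd1 (X s' t') (Y s' t')) as [D1 D2]; [fold dX; lra|fold dY; lra|].
  destruct (Hd2 s t) as [[I3 I4] _];
    try (rewrite Rminus_diag, Rabs_R0; apply cond_pos).
  fold dX dY in D1, D2. rewrite I1, I3 in D1. rewrite I2, I4 in D2.
  set (E1 := s' - s - (a * dX + b * dY)) in *.
  set (E2 := t' - t - (c * dX + d * dY)) in *.
  set (B := Rmax (Rabs dX) (Rabs dY)) in *.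
  assert (BM : B <= 2 * K * M) by (apply Rmax_lub; lra).
  assert (eB : e * B <= eps * Rabs J / T * M).
  { apply Rle_trans with (e * (2 * K * M)).
    - apply Rmult_le_compat_l; [apply Rlt_le, cond_pos|auto].
    - apply Req_le. simpl. field. split; lra. }
  set (N := eps * Rabs J / T * M) in *.
  assert (fin : forall al be, Rabs al + Rabs be <= T ->
    Rabs ((al * E1 + be * E2) / J) <= eps * M).
  { intros al be Hab. unfold Rdiv. rewrite Rabs_mult, Rabs_inv.
    apply Rle_trans with ((T * N) * / Rabs J).
    2:{ apply Req_le. unfold N. field. split; lra. }
    apply Rmult_le_compat_r; [apply Rlt_le, Rinv_0_lt_compat, Ja|].
    apply Rle_trans with (1 := Rabs_triang _ _). rewrite !Rabs_mult.
    assert (pal := Rabs_pos al). assert (pbe := Rabs_pos be).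
    assert (N0 : 0 <= N) by (apply Rle_trans with (Rabs E1); [apply Rabs_pos|lra]).
    apply Rle_trans with (Rabs al * N + Rabs be * N).
    - apply Rplus_le_compat; apply Rmult_le_compat_l; lra.
    - rewrite <- Rmult_plus_distr_r. apply Rmult_le_compat_r; auto. }
  split.
  - replace (dX - (d / J * (s' - s) + - b / J * (t' - t)))
      with (((- d) * E1 + b * E2) / J)
      by (unfold E1, E2, J; field; exact J0).
    apply fin. rewrite Rabs_Ropp. unfold T; lra.
  - replace (dY - (- c / J * (s' - s) + a / J * (t' - t)))
      with ((c * E1 + (- a) * E2) / J)
      by (unfold E1, E2, J; field; exact J0).
    apply fin. rewrite Rabs_Ropp. unfold T; lra.
Qed.

Definition jacobian (f1 f2 : R -> R -> R) (x y : R) : R :=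
  pdx f1 x y * pdy f2 x y - pdy f1 x y * pdx f2 x y.

(** Newton's map [q - A^{-1} f(q)], with [A] the derivative at the centre, has
    zero derivative there, hence is a contraction on a small square.  The
    numbers [a, b, c, d] are the entries of [A^{-1}]. *)
Lemma newton_contraction U f1 f2 x0 y0 :
  open U -> Ck 1 U f1 -> Ck 1 U f2 -> U (x0, y0) -> jacobian f1 f2 x0 y0 <> 0 ->
  exists (r a b c d : R), 0 < r /\ a * d - b * c <> 0 /\
    (forall q, square x0 y0 r q -> U q) /\
    (forall x y, square x0 y0 r (x, y) -> jacobian f1 f2 x y <> 0) /\
    forall p q, square x0 y0 r p -> square x0 y0 r q ->
      dist1 (fst p - (a * f1 (fst p) (snd p) + b * f2 (fst p) (snd p)),
             snd p - (c * f1 (fst p) (snd p) + d * f2 (fst p) (snd p)))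
            (fst q - (a * f1 (fst q) (snd q) + b * f2 (fst q) (snd q)),
             snd q - (c * f1 (fst q) (snd q) + d * f2 (fst q) (snd q)))
        <= 1 / 2 * dist1 p q.
Proof.
  intros oU H1 H2 U0 J0.
  set (J := jacobian f1 f2 x0 y0) in *.
  set (a := pdy f2 x0 y0 / J). set (b := - pdy f1 x0 y0 / J).
  set (c := - pdx f2 x0 y0 / J). set (d := pdx f1 x0 y0 / J).
  assert (C1x := Ck_pdx _ _ _ H1). assert (C1y := Ck_pdy _ _ _ H1).
  assert (C2x := Ck_pdx _ _ _ H2). assert (C2y := Ck_pdy _ _ _ H2).
  assert (cont : forall al be ga f g, Ck 0 U f -> Ck 0 U g ->
    continuity_2d_pt (fun x y => al - (be * f x y + ga * g x y)) x0 y0).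
  { intros al be ga f g Hf Hg. apply (Ck_continuous 0 U); auto.
    apply Ck_minus, Ck_plus; auto using Ck_mult, Ck_const. }
  (* partial derivatives below 1/4 give the Lipschitz constant 1/2 for dist1,
     since each of the two components contributes 1/4 *)
  assert (quarter : 0 < 1 / 4) by lra.
  assert (small : forall al be ga f g, Ck 0 U f -> Ck 0 U g ->
    al - (be * f x0 y0 + ga * g x0 y0) = 0 ->
    locally_2d (fun x y => Rabs (al - (be * f x y + ga * g x y)) < 1 / 4) x0 y0).
  { intros al be ga f g Hf Hg E.
    destruct (cont al be ga f g Hf Hg (mkposreal _ quarter)) as [r Hr].
    exists r. intros u v Hu Hv. specialize (Hr u v Hu Hv).
    rewrite E, Rminus_0_r in Hr. exact Hr. }
  assert (Jdef : J = pdx f1 x0 y0 * pdy f2 x0 y0 - pdy f1 x0 y0 * pdx f2 x0 y0)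
    by reflexivity.
  assert (S11 := small 1 a b _ _ C1x C2x). assert (S12 := small 0 a b _ _ C1y C2y).
  assert (S21 := small 0 c d _ _ C1x C2x). assert (S22 := small 1 c d _ _ C1y C2y).
  assert (SJ : locally_2d (fun x y => jacobian f1 f2 x y <> 0) x0 y0).
  { apply continuity_2d_pt_neq_0; auto.
    apply (Ck_continuous 0 U); auto. apply Ck_minus; auto using Ck_mult. }
  lapply S11; [clear S11; intros S11|unfold a, b; rewrite Jdef; field; now rewrite <- Jdef].
  lapply S12; [clear S12; intros S12|unfold a, b; rewrite Jdef; field; now rewrite <- Jdef].
  lapply S21; [clear S21; intros S21|unfold c, d; rewrite Jdef; field; now rewrite <- Jdef].
  lapply S22; [clear S22; intros S22|unfold c, d; rewrite Jdef; field; now rewrite <- Jdef].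
  destruct (locally_2d_and _ _ _ _ (open_locally_2d U _ _ oU U0)
    (locally_2d_and _ _ _ _ SJ
    (locally_2d_and _ _ _ _ (locally_2d_and _ _ _ _ S11 S12)
                            (locally_2d_and _ _ _ _ S21 S22)))) as [r Hr].
  exists r, a, b, c, d.
  assert (sqU : forall q, square x0 y0 r q -> U q).
  { intros [x y] [Hx Hy]. apply (Hr x y Hx Hy). }
  split; [apply cond_pos|]. split.
  { replace (a * d - b * c) with (/ J).
    - now apply Rinv_neq_0_compat.
    - unfold a, b, c, d. rewrite Jdef. field. now rewrite <- Jdef. }
  split; [exact sqU|]. split.
  { intros x y [Hx Hy]. apply (Hr x y Hx Hy). }
  assert (D1 : forall x y, square x0 y0 r (x, y) ->
    differentiable_pt_lim f1 x y (pdx f1 x y) (pdy f1 x y)).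
  { intros x y Hxy. apply (Ck_differentiable 0 U); auto. }
  assert (D2 : forall x y, square x0 y0 r (x, y) ->
    differentiable_pt_lim f2 x y (pdx f2 x y) (pdy f2 x y)).
  { intros x y Hxy. apply (Ck_differentiable 0 U); auto. }
  assert (Dc : forall k x y, differentiable_pt_lim (fun _ _ => k) x y 0 0).
  { intros k x y. apply (differentiable_of_is_derive_x (fun _ => k)).
    apply @is_derive_const. }
  assert (Dlin : forall h al be hx hy x y, square x0 y0 r (x, y) ->
     differentiable_pt_lim h x y hx hy ->
     differentiable_pt_lim (fun u v => h u v - (al * f1 u v + be * f2 u v)) x y
       (hx - (al * pdx f1 x y + be * pdx f2 x y))
       (hy - (al * pdy f1 x y + be * pdy f2 x y))).
  { intros h al be hx hy x y Hxy Hh.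
    eapply differentiable_pt_lim_ext with
      (f1 := fun u v => h u v + ((- al) * f1 u v + (- be) * f2 u v)).
    { apply locally_2d_forall; intros; ring. }
    replace (hx - (al * pdx f1 x y + be * pdx f2 x y)) with
      (hx + ((0 * f1 x y + (- al) * pdx f1 x y) + (0 * f2 x y + (- be) * pdx f2 x y)))
      by ring.
    replace (hy - (al * pdy f1 x y + be * pdy f2 x y)) with
      (hy + ((0 * f1 x y + (- al) * pdy f1 x y) + (0 * f2 x y + (- be) * pdy f2 x y)))
      by ring.
    apply differentiable_plus; auto. apply differentiable_plus.
    - apply (differentiable_mult (fun _ _ => - al) f1); auto.
    - apply (differentiable_mult (fun _ _ => - be) f2); auto. }
  intros [x y] [x' y'] Hp Hq. unfold dist1; simpl.
  assert (M1 := mean_value_square (fun u v => u - (a * f1 u v + b * f2 u v))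
    _ _ x0 y0 r (1 / 4) (fun x y H => Dlin _ a b 1 0 x y H (differentiable_id1 x y))).
  assert (M2 := mean_value_square (fun u v => v - (c * f1 u v + d * f2 u v))
    _ _ x0 y0 r (1 / 4) (fun x y H => Dlin _ c d 0 1 x y H (differentiable_id2 x y))).
  lapply M1; [clear M1; intros M1|].
  2:{ intros u v [Hu Hv].
      destruct (Hr u v Hu Hv) as [_ [_ [[A B] _]]]. split; now apply Rlt_le. }
  lapply M2; [clear M2; intros M2|].
  2:{ intros u v [Hu Hv].
      destruct (Hr u v Hu Hv) as [_ [_ [_ [A B]]]]. split; now apply Rlt_le. }
  generalize (M1 _ _ _ _ Hq Hp) (M2 _ _ _ _ Hq Hp). simpl. lra.
Qed.

(** The inverse is as smooth as the map because the derivative of the inverse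
    is the inverse matrix evaluated along the inverse itself, so each order of
    differentiability gives the next. *)
Lemma inverse_smooth V W f1 f2 X Y :
  open V -> open W -> smooth_on V f1 -> smooth_on V f2 ->
  (forall x y, V (x, y) -> jacobian f1 f2 x y <> 0) ->
  (forall s t, W (s, t) -> V (X s t, Y s t)) ->
  (forall s t, W (s, t) ->
    differentiable_pt_lim X s t
      (pdy f2 (X s t) (Y s t) / jacobian f1 f2 (X s t) (Y s t))
      (- pdy f1 (X s t) (Y s t) / jacobian f1 f2 (X s t) (Y s t)) /\
    differentiable_pt_lim Y s t
      (- pdx f2 (X s t) (Y s t) / jacobian f1 f2 (X s t) (Y s t))
      (pdx f1 (X s t) (Y s t) / jacobian f1 f2 (X s t) (Y s t))) ->
  smooth_on W X /\ smooth_on W Y.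
Proof.
  intros oV oW H1 H2 J0 WV Hd.
  assert (main : forall k, Ck k W X /\ Ck k W Y).
  { induction k as [|k [IX IY]].
    - split; intros s t Wst; split; auto; apply differentiable_continuity_pt;
        destruct (Hd s t Wst); now do 2 eexists; eauto.
    - assert (C1x : Ck k V (pdx f1)) by (apply Ck_pdx; intros x y; apply H1).
      assert (C1y : Ck k V (pdy f1)) by (apply Ck_pdy; intros x y; apply H1).
      assert (C2x : Ck k V (pdx f2)) by (apply Ck_pdx; intros x y; apply H2).
      assert (C2y : Ck k V (pdy f2)) by (apply Ck_pdy; intros x y; apply H2).
      assert (CJ : Ck k V (fun x y => / jacobian f1 f2 x y)).
      { apply Ck_inv; auto. apply Ck_minus; auto using Ck_mult. }
      assert (quot : forall f, Ck k V f ->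
        Ck k W (fun s t => f (X s t) (Y s t) / jacobian f1 f2 (X s t) (Y s t))).
      { intros f Hf.
        apply (Ck_comp k W V (fun x y => f x y * / jacobian f1 f2 x y)); auto.
        apply Ck_mult; auto. }
      split.
      + eapply Ck_S_intro; auto.
        * intros s t Wst. apply (Hd s t Wst).
        * apply (quot (pdy f2)); auto.
        * apply (quot (fun x y => - pdy f1 x y)), Ck_opp; auto.
      + eapply Ck_S_intro; auto.
        * intros s t Wst. apply (Hd s t Wst).
        * apply (quot (fun x y => - pdx f2 x y)), Ck_opp; auto.
        * apply (quot (pdx f1)); auto. }
  split; intros n x y Wxy; now apply main.
Qed.

(** For a value [w] close to the one at the centre, the preimage of [w] is the
    fixed point of [q - A^{-1} (f(q) - w)], a translate of Newton's map; the
    contraction property also makes the inverse Lipschitz. *)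
Theorem inverse_function (U : R * R -> Prop) (f1 f2 : R -> R -> R) (x0 y0 : R) :
  open U -> smooth_on U f1 -> smooth_on U f2 -> U (x0, y0) ->
  jacobian f1 f2 x0 y0 <> 0 ->
  exists (V W : R * R -> Prop) (X Y : R -> R -> R),
    open V /\ open W /\ V (x0, y0) /\ (forall q, V q -> U q) /\
    (forall x y, V (x, y) -> jacobian f1 f2 x y <> 0) /\
    smooth_on W X /\ smooth_on W Y /\
    (forall x y, V (x, y) -> W (f1 x y, f2 x y) /\
       X (f1 x y) (f2 x y) = x /\ Y (f1 x y) (f2 x y) = y) /\
    (forall s t, W (s, t) -> V (X s t, Y s t) /\
       f1 (X s t) (Y s t) = s /\ f2 (X s t) (Y s t) = t).
Proof.
  intros oU H1 H2 U0 J0.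
  assert (K1 : forall k, Ck k U f1) by (intros k x y; apply H1).
  assert (K2 : forall k, Ck k U f2) by (intros k x y; apply H2).
  destruct (newton_contraction U f1 f2 x0 y0 oU (K1 1%nat) (K2 1%nat) U0 J0)
    as (r & a & b & c & d & r0 & dt0 & sqU & sqJ & contr).
  set (B := square x0 y0 r) in *.
  assert (oB : open B) by apply open_square.
  set (s0 := f1 x0 y0). set (t0 := f2 x0 y0).
  (* the values for which the step of the translated map at the centre is
     below r / 2 *)
  set (W := fun q : R * R => True /\
     square 0 0 (r / 4) (a * (fst q - s0) + b * (snd q - t0),
                         c * (fst q - s0) + d * (snd q - t0))).
  assert (oT : open (fun _ : R * R => True)) by apply open_true.
  assert (oW : open W).
  { apply (open_preimage (fun _ => True) (square 0 0 (r / 4))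
      (fun s t => a * (s - s0) + b * (t - t0)) (fun s t => c * (s - s0) + d * (t - t0)));
      auto using open_square;
      apply Ck_plus; auto; apply Ck_mult; auto using Ck_const; apply Ck_minus;
      auto using Ck_const, Ck_id1, Ck_id2. }
  set (V := fun q : R * R => B q /\ W (f1 (fst q) (snd q), f2 (fst q) (snd q))).
  assert (oV : open V).
  { apply open_preimage; auto; now apply (Ck_sub 0 B U). }
  assert (surj : forall w, W w -> exists q, V q /\
     f1 (fst q) (snd q) = fst w /\ f2 (fst q) (snd q) = snd w).
  { intros [s t] Ww.
    destruct (contraction_fixed_point (fun q =>
      (fst q - (a * f1 (fst q) (snd q) + b * f2 (fst q) (snd q)) + (a * s + b * t),
       snd q - (c * f1 (fst q) (snd q) + d * f2 (fst q) (snd q)) + (c * s + d * t)))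
      x0 y0 r) as [q [Bq Eq]].
    - intros p q Bp Bq. apply Rle_trans with (2 := contr p q Bp Bq).
      apply Req_le. unfold dist1; simpl. f_equal; f_equal; ring.
    - destruct Ww as [_ [A1 A2]]; simpl in A1, A2. unfold dist1; simpl.
      fold s0 t0. rewrite Rminus_0_r in A1, A2.
      match goal with |- Rabs ?u + Rabs ?v < _ =>
        replace u with (a * (s - s0) + b * (t - t0)) by ring;
        replace v with (c * (s - s0) + d * (t - t0)) by ring end.
      lra.
    - exists q.
      assert (F1 := f_equal fst Eq). assert (F2 := f_equal snd Eq). simpl in F1, F2.
      set (u := f1 (fst q) (snd q) - s). set (v := f2 (fst q) (snd q) - t).
      assert (G1 : a * u + b * v = 0) by (unfold u, v; lra).
      assert (G2 : c * u + d * v = 0) by (unfold u, v; lra).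
      assert (u0 : u = 0).
      { apply Rmult_eq_reg_l with (a * d - b * c); auto.
        replace ((a * d - b * c) * u) with (d * (a * u + b * v) - b * (c * u + d * v))
          by ring. rewrite G1, G2; ring. }
      assert (v0 : v = 0).
      { apply Rmult_eq_reg_l with (a * d - b * c); auto.
        replace ((a * d - b * c) * v) with (a * (c * u + d * v) - c * (a * u + b * v))
          by ring. rewrite G1, G2; ring. }
      assert (e1 : f1 (fst q) (snd q) = s) by (unfold u in u0; lra).
      assert (e2 : f2 (fst q) (snd q) = t) by (unfold v in v0; lra).
      simpl. split; [|now split]. split; [exact Bq|]. simpl. now rewrite e1, e2. }
  set (K := 2 * (Rabs a + Rabs b + Rabs c + Rabs d + 1)).
  assert (pa := Rabs_pos a). assert (pb := Rabs_pos b).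
  assert (pc := Rabs_pos c). assert (pd := Rabs_pos d).
  assert (K0 : 0 < K) by (unfold K; lra).
  assert (lip : forall p q, B p -> B q -> dist1 p q <=
     K * dist1 (f1 (fst p) (snd p), f2 (fst p) (snd p))
               (f1 (fst q) (snd q), f2 (fst q) (snd q))).
  { intros p q Bp Bq. specialize (contr p q Bp Bq).
    unfold dist1 in *; simpl in *.
    set (u := f1 (fst p) (snd p)) in *. set (u' := f1 (fst q) (snd q)) in *.
    set (v := f2 (fst p) (snd p)) in *. set (v' := f2 (fst q) (snd q)) in *.
    assert (tri : forall al be x x', Rabs (x - x') <=
       Rabs (x - (al * u + be * v) - (x' - (al * u' + be * v')))
       + (Rabs al * Rabs (u - u') + Rabs be * Rabs (v - v'))).
    { intros al be x x'.
      replace (x - x') with ((x - (al * u + be * v) - (x' - (al * u' + be * v')))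
        + (al * (u - u') + be * (v - v'))) at 1 by ring.
      apply Rle_trans with (1 := Rabs_triang _ _). apply Rplus_le_compat_l.
      apply Rle_trans with (1 := Rabs_triang _ _). rewrite !Rabs_mult. lra. }
    generalize (tri a b (fst p) (fst q)) (tri c d (snd p) (snd q)).
    assert (pu := Rabs_pos (u - u')). assert (pv := Rabs_pos (v - v')).
    unfold K. nra. }
  assert (inj : forall p q, B p -> B q ->
     f1 (fst p) (snd p) = f1 (fst q) (snd q) ->
     f2 (fst p) (snd p) = f2 (fst q) (snd q) -> p = q).
  { intros p q Bp Bq e1 e2. specialize (lip p q Bp Bq). rewrite e1, e2 in lip.
    unfold dist1 in lip; simpl in lip. rewrite !Rminus_diag, Rabs_R0 in lip.
    assert (p1 := Rabs_pos (fst p - fst q)). assert (p2 := Rabs_pos (snd p - snd q)).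
    assert (z1 : Rabs (fst p - fst q) = 0) by lra.
    assert (z2 : Rabs (snd p - snd q) = 0) by lra.
    apply Rabs_eq_0 in z1. apply Rabs_eq_0 in z2. apply injective_projections; lra. }
  set (sel := fun s t => epsilon (inhabits (x0, y0)) (fun q => V q /\
     f1 (fst q) (snd q) = s /\ f2 (fst q) (snd q) = t)).
  assert (Hsel : forall s t, W (s, t) -> V (sel s t) /\
     f1 (fst (sel s t)) (snd (sel s t)) = s /\ f2 (fst (sel s t)) (snd (sel s t)) = t).
  { intros s t Wst. apply (epsilon_spec (inhabits (x0, y0)) (fun q => V q /\
     f1 (fst q) (snd q) = s /\ f2 (fst q) (snd q) = t)). exact (surj (s, t) Wst). }
  exists V, W, (fun s t => fst (sel s t)), (fun s t => snd (sel s t)).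
  assert (VW : forall x y, V (x, y) -> W (f1 x y, f2 x y)).
  { intros x y [_ H]. exact H. }
  assert (smooth : smooth_on W (fun s t => fst (sel s t)) /\
                   smooth_on W (fun s t => snd (sel s t))).
  { apply (inverse_smooth V W f1 f2); auto.
    - intros n x y Vxy. apply H1, sqU, Vxy.
    - intros n x y Vxy. apply H2, sqU, Vxy.
    - intros x y Vxy. apply sqJ, Vxy.
    - intros s t Wst. rewrite <- surjective_pairing. now apply Hsel.
    - intros s t Wst. destruct (Hsel s t Wst) as [[Bst _] [e1 e2]].
      set (x := fst (sel s t)). set (y := snd (sel s t)).
      assert (Bxy : B (x, y)) by (unfold x, y; now rewrite <- surjective_pairing).
      apply (inverse_differentiable f1 f2 (fun s t => fst (sel s t))
               (fun s t => snd (sel s t)) s t _ _ _ _ K); auto.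
      + apply (Ck_differentiable 0 U); auto.
      + apply (Ck_differentiable 0 U); auto.
      + apply (sqJ x y Bxy).
      + destruct (open_locally_2d W s t oW Wst) as [dl Hdl]. exists dl.
        intros s' t' Hs Ht. now apply Hsel, Hdl.
      + destruct (open_locally_2d W s t oW Wst) as [dl Hdl]. exists dl.
        intros s' t' Hs Ht. destruct (Hsel s' t' (Hdl _ _ Hs Ht)) as [[Bst' _] [e1' e2']].
        assert (L := lip _ _ Bst' Bst). rewrite e1, e2, e1', e2' in L. exact L. }
  split; [exact oV|]. split; [exact oW|]. split.
  { split; [split; simpl; rewrite Rminus_diag, Rabs_R0; exact r0|].
    split; auto. simpl. fold s0 t0. rewrite !Rminus_diag, !Rmult_0_r, Rplus_0_r.
    split; simpl; rewrite Rminus_0_r, Rabs_R0; lra. }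
  split; [intros q [Bq _]; now apply sqU|]. split; [intros x y [Bq _]; now apply sqJ|].
  split; [apply smooth|]. split; [apply smooth|]. split.
  - intros x y Vxy. split; [now apply VW|].
    destruct (Hsel _ _ (VW x y Vxy)) as [[Bs _] [e1 e2]].
    assert (E : sel (f1 x y) (f2 x y) = (x, y)).
    { apply inj; auto. apply Vxy. }
    rewrite E. auto.
  - intros s t Wst. rewrite <- surjective_pairing. now apply Hsel.
Qed.

(** * Closed forms, primitives and complex integrals *)

Lemma continuity_2d_x f x y : continuity_2d_pt f x y -> continuous (fun t => f t y) x.
Proof.
  intros H. apply (continuous_comp_2 (fun t => t) (fun _ => y) f).
  - apply continuous_id. - apply continuous_const.
  - now apply continuity_2d_pt_filterlim in H.
Qed.

Lemma continuity_2d_y f x y : continuity_2d_pt f x y -> continuous (fun t => f x t) y.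
Proof.
  intros H. apply (continuous_comp_2 (fun _ => x) (fun t => t) f).
  - apply continuous_const. - apply continuous_id.
  - now apply continuity_2d_pt_filterlim in H.
Qed.

(** Integrating along the first axis and then parallel to the second gives
    the second partial derivative at once; the first one follows by
    differentiating under the integral sign and using closedness. *)
Lemma poincare_square a b (x0 y0 r : R) :
  Ck 1 (square x0 y0 r) a -> Ck 1 (square x0 y0 r) b ->
  (forall x y, square x0 y0 r (x, y) -> pdy a x y = pdx b x y) ->
  exists P, forall x y, square x0 y0 r (x, y) ->
    differentiable_pt_lim P x y (a x y) (b x y).
Proof.
  intros Ha Hb closed. set (B := square x0 y0 r) in *.
  assert (oB : open B) by apply open_square.
  assert (center : forall x y, B (x, y) -> B (x, y0) /\ B (x0, y0)).
  { intros x y [Hx Hy]; simpl in *. assert (px := Rabs_pos (x - x0)).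
    repeat split; simpl; try rewrite Rminus_diag, Rabs_R0; lra. }
  assert (segy : forall x y t, B (x, y) -> Rmin y0 y <= t <= Rmax y0 y -> B (x, t)).
  { intros x y t Bxy Ht. split; [apply Bxy|].
    destruct (center x y Bxy) as [[_ Hy0] _].
    apply (interval_between y0 r y0 y); auto. apply Bxy. }
  assert (intb : forall x y y', B (x, y) -> B (x, y') ->
     ex_RInt (fun t => b x t) y y').
  { intros x y y' Hy Hy'. apply (ex_RInt_continuous (V := R_CompleteNormedModule)).
    intros t Ht. apply continuity_2d_y, (Ck_continuous 1 B); auto.
    split; [apply Hy|]. apply (interval_between y0 r y y'); [apply Hy|apply Hy'|auto]. }
  assert (inta : forall x x' y, B (x, y) -> B (x', y) ->
     ex_RInt (fun t => a t y) x x').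
  { intros x x' y Hx Hx'. apply (ex_RInt_continuous (V := R_CompleteNormedModule)).
    intros t Ht. apply (continuity_2d_x a), (Ck_continuous 1 B); auto.
    split; [|apply Hx]. apply (interval_between x0 r x x'); [apply Hx|apply Hx'|auto]. }
  exists (fun x y => RInt (fun t => a t y0) x0 x + RInt (fun t => b x t) y0 y).
  assert (near_x : forall x y, B (x, y) -> locally x (fun u => B (u, y))).
  { intros x y Bxy.
    exact (locally_2d_1d_const_y (fun u v => B (u, v)) x y
             (open_locally_2d B x y oB Bxy)). }
  assert (near_y : forall x y, B (x, y) -> locally y (fun v => B (x, v))).
  { intros x y Bxy.
    exact (locally_2d_1d_const_x (fun u v => B (u, v)) x y
             (open_locally_2d B x y oB Bxy)). }
  assert (Hx : forall x y, B (x, y) -> is_derive (fun u =>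
     RInt (fun t => a t y0) x0 u + RInt (fun t => b u t) y0 y) x (a x y)).
  { intros x y Bxy. destruct (center x y Bxy) as [Bx0 B0].
    replace (a x y) with (a x y0 + (a x y - a x y0)) by ring.
    apply (is_derive_plus (fun u => RInt (fun t => a t y0) x0 u)
                          (fun u => RInt (fun t => b u t) y0 y)).
    - apply (is_derive_RInt (fun t => a t y0) (fun u => RInt (fun t => a t y0) x0 u) x0).
      + apply (filter_imp (fun u => B (u, y0))); [|now apply near_x].
        intros u Bu. apply (RInt_correct (V := R_CompleteNormedModule)). now apply inta.
      + apply (continuity_2d_x a), (Ck_continuous 1 B); auto.
    - replace (a x y - a x y0) with
        (RInt (fun t => Derive (fun u => b u t) x) y0 y).
      + apply is_derive_RInt_param.
        * apply (filter_imp (fun u => B (u, y))); [|now apply near_x].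
          intros u Bu t Ht. destruct (Hb u t (segy u y t Bu Ht)) as [_ [D _]]. exact D.
        * intros t Ht. apply (Ck_continuous 0 B (pdx b)).
          -- now apply Ck_pdx. -- now apply (segy x y).
        * apply (filter_imp (fun u => B (u, y))); [|now apply near_x].
          intros u Bu. apply intb; auto. now apply (center u y).
      + rewrite (RInt_ext _ (fun t => Derive (fun v => a x v) t)).
        * apply (RInt_Derive (fun v => a x v)).
          -- intros t Ht. destruct (Ha x t (segy x y t Bxy Ht)) as [_ [_ [D _]]]. exact D.
          -- intros t Ht. apply (continuity_2d_y (pdy a)), (Ck_continuous 0 B).
             ++ now apply Ck_pdy. ++ now apply (segy x y).
        * intros t Ht. symmetry. apply (closed x t), (segy x y); auto. lra. }
  assert (Hy : forall x y, B (x, y) -> is_derive (fun v =>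
     RInt (fun t => a t y0) x0 x + RInt (fun t => b x t) y0 v) y (b x y)).
  { intros x y Bxy. destruct (center x y Bxy) as [Bx0 B0].
    replace (b x y) with (0 + b x y) by ring.
    apply (is_derive_plus (fun _ => RInt (fun t => a t y0) x0 x)
                          (fun v => RInt (fun t => b x t) y0 v));
      [apply @is_derive_const|].
    apply (is_derive_RInt (fun t => b x t) (fun v => RInt (fun t => b x t) y0 v) y0).
    - apply (filter_imp (fun v => B (x, v))); [|now apply near_y].
      intros v Bv. apply (RInt_correct (V := R_CompleteNormedModule)). now apply intb.
    - apply (continuity_2d_y b), (Ck_continuous 1 B); auto. }
  intros x y Bxy. apply filterdiff_differentiable_pt_lim.
  apply (is_derive_filterdiff
    (fun x y => RInt (fun t => a t y0) x0 x + RInt (fun t => b x t) y0 y) x y a).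
  - apply (filter_imp B); [|exact (oB _ Bxy)]. intros [u v] Buv. now apply Hx.
  - now apply Hy.
  - apply continuity_2d_pt_filterlim, (Ck_continuous 1 B); auto.
Qed.

Definition complex_of (P Q : R -> R -> R) (w : C) : C :=
  (P (Re w) (Im w), Q (Re w) (Im w)).

(** Cauchy-Riemann: the real differential is multiplication by [(h1, h2)]. *)
Lemma cauchy_riemann P Q x y h1 h2 :
  differentiable_pt_lim P x y h1 (- h2) -> differentiable_pt_lim Q x y h2 h1 ->
  is_derive (K := C_AbsRing) (V := C_NormedModule) (complex_of P Q) (x, y) (h1, h2).
Proof.
  intros HP HQ. split; [apply is_linear_scal_l|].
  intros z Hz. apply (is_filter_lim_locally_unique (K := C_AbsRing) (V := AbsRing_NormedModule C_AbsRing)) in Hz. subst z.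
  intros eps.
  (* the modulus is at most sqrt 2 <= 2 times the larger component *)
  assert (e2 : 0 < eps / 2) by (generalize (cond_pos eps); lra).
  set (e := mkposreal _ e2).
  apply locally_C.
  generalize (proj1 (locally_2d_locally _ _ _)
    (locally_2d_and _ _ _ _ (HP e) (HQ e))).
  apply filter_imp. intros [u v] [A B]; simpl in A, B.
  apply Rle_trans with (1 := Cmod_2Rmax _).
  set (dz := minus (u, v) (x, y) : C).
  assert (D := Rmax_Cmod dz). simpl in D.
  set (m := Rmax (Rabs (u - x)) (Rabs (v - y))) in *.
  change (Rmax (Rabs (u + - x)) (Rabs (v + - y))) with m in D.
  change (norm dz) with (Cmod dz).
  assert (m0 : 0 <= m) by (apply Rle_trans with (2 := Rmax_l _ _); apply Rabs_pos).
  match goal with |- sqrt 2 * ?M <= _ => assert (E : M <= eps / 2 * m) end.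
  { apply Rmax_lub; simpl.
    - eapply Rle_trans; [|exact A]. apply Req_le. f_equal.
      unfold complex_of, plus, opp, scal; simpl. unfold mult; simpl. ring.
    - eapply Rle_trans; [|exact B]. apply Req_le. f_equal.
      unfold complex_of, plus, opp, scal; simpl. unfold mult; simpl. ring. }
  assert (s2 : sqrt 2 <= 2).
  { rewrite <- (sqrt_square 2) at 2 by lra. apply sqrt_le_1; lra. }
  assert (s0 := sqrt_pos 2).
  apply Rle_trans with (2 * (eps / 2 * m)).
  - apply Rle_trans with (sqrt 2 * (eps / 2 * m)).
    + now apply Rmult_le_compat_l.
    + apply Rmult_le_compat_r; auto. apply Rmult_le_pos; lra.
  - replace (2 * (eps / 2 * m)) with (eps * m) by field.
    apply Rmult_le_compat_l; auto. apply Rlt_le, cond_pos.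
Qed.

(** The real part of [g dw] is [dX], so that along the segment this is the
    fundamental theorem of calculus. *)
Lemma Re_cint_primitive X g1 g2 (g : C -> C) x0 y0 r (a b : C) :
  (forall x y, square x0 y0 r (x, y) ->
     differentiable_pt_lim X x y (g1 x y) (- g2 x y)) ->
  Ck 0 (square x0 y0 r) g1 -> Ck 0 (square x0 y0 r) g2 ->
  (forall x y, square x0 y0 r (x, y) -> g (x, y) = (g1 x y, g2 x y)) ->
  square x0 y0 r a -> square x0 y0 r b ->
  Re (cint g a b) = X (Re b) (Im b) - X (Re a) (Im a).
Proof.
  intros HX C1 C2 Hg Ba Bb. destruct a as [a1 a2], b as [b1 b2].
  set (B := square x0 y0 r) in *.
  set (p := fun t => a1 + t * (b1 - a1)). set (q := fun t => a2 + t * (b2 - a2)).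
  assert (conv : forall z r a b t, Rabs (a - z) < r -> Rabs (b - z) < r ->
    0 <= t <= 1 -> Rabs (a + t * (b - a) - z) < r).
  { intros z r' a b t Ha Hb Ht. apply Rabs_def2 in Ha. apply Rabs_def2 in Hb.
    destruct (Rle_lt_dec a b).
    - assert (0 <= t * (b - a) <= b - a) by nra. apply Rabs_def1; lra.
    - assert (0 <= t * (a - b) <= a - b) by nra. apply Rabs_def1; lra. }
  assert (seg : forall t, 0 <= t <= 1 -> B (p t, q t)).
  { intros t Ht. split; apply conv; auto; try apply Ba; try apply Bb. }
  assert (dp : forall t, is_derive p t (b1 - a1)).
  { intros t. unfold p. auto_derive; auto; ring. }
  assert (dq : forall t, is_derive q t (b2 - a2)).
  { intros t. unfold q. auto_derive; auto; ring. }
  assert (cpq : forall f, Ck 0 B f -> forall t, 0 <= t <= 1 ->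
    continuous (fun t => f (p t) (q t)) t).
  { intros f Hf t Ht. apply (continuous_comp_2 p q f).
    - apply (ex_derive_continuous p). eexists; apply dp.
    - apply (ex_derive_continuous q). eexists; apply dq.
    - apply (continuity_2d_pt_filterlim f (p t) (q t)), (Ck_continuous 0 B); auto. }
  set (h1 := fun t => g1 (p t) (q t) * (b1 - a1) - g2 (p t) (q t) * (b2 - a2)).
  set (h2 := fun t => g1 (p t) (q t) * (b2 - a2) + g2 (p t) (q t) * (b1 - a1)).
  assert (I1 : is_RInt h1 0 1 (X b1 b2 - X a1 a2)).
  { replace (X b1 b2 - X a1 a2) with
      (minus ((fun t => X (p t) (q t)) 1) ((fun t => X (p t) (q t)) 0)).
    - apply (is_RInt_derive (V := R_CompleteNormedModule)
               (fun t => X (p t) (q t)) h1).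
      + intros t Ht. rewrite Rmin_left, Rmax_right in Ht by lra.
        replace (h1 t) with
          (g1 (p t) (q t) * (b1 - a1) + (- g2 (p t) (q t)) * (b2 - a2))
          by (unfold h1; ring).
        apply is_derive_Reals, derivable_pt_lim_comp_2d.
        * now apply HX, seg. * now apply is_derive_Reals. * now apply is_derive_Reals.
      + intros t Ht. rewrite Rmin_left, Rmax_right in Ht by lra.
        apply @continuous_minus; apply @continuous_mult; auto;
          apply continuous_const.
    - unfold minus, plus, opp, p, q; simpl. unfold Rminus.
      f_equal; [|f_equal]; f_equal; ring. }
  assert (I2 : is_RInt h2 0 1 (RInt h2 0 1)).
  { apply (RInt_correct (V := R_CompleteNormedModule)).
    apply (ex_RInt_continuous (V := R_CompleteNormedModule)).
    intros t Ht. rewrite Rmin_left, Rmax_right in Ht by lra.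
    apply @continuous_plus; apply @continuous_mult; auto; apply continuous_const. }
  assert (I : is_RInt (V := C_R_CompleteNormedModule)
    (fun t => (g ((a1, a2) + RtoC t * ((b1, b2) - (a1, a2))) * ((b1, b2) - (a1, a2)))%C)
    0 1 (X b1 b2 - X a1 a2, RInt h2 0 1)).
  { apply (is_RInt_ext (V := C_R_CompleteNormedModule) (fun t => (h1 t, h2 t))).
    - intros t Ht. rewrite Rmin_left, Rmax_right in Ht by lra.
      replace ((a1, a2) + RtoC t * ((b1, b2) - (a1, a2)))%C with (p t, q t).
      + rewrite Hg by (apply seg; lra). unfold h1, h2.
        apply injective_projections; simpl; ring.
      + unfold p, q. apply injective_projections; simpl; ring.
    - exact (is_RInt_fct_extend_pair (U := R_NormedModule) (V := R_NormedModule)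
        (fun t => (h1 t, h2 t)) 0 1 _ _ I1 I2). }
  unfold cint. rewrite (is_RInt_unique (V := C_R_CompleteNormedModule) _ _ _ _ I).
  reflexivity.
Qed.

(** * The Gauss map as a function of the gradient *)

(** For [grad phi = (p, q)] one has [zeta = (p + i q) / gauss_den p q]: the
    quotient in the definition of [zeta], rationalised so that its denominator
    never vanishes. *)
Definition gauss_den (p q : R) : R := 1 + sqrt (1 + (p ^ 2 + q ^ 2)).

Definition unit_disc (w : R * R) : Prop := fst w ^ 2 + snd w ^ 2 < 1.

(** The components of [2 u], as functions of [zeta = s + i t], where
    [u = zeta / (1 - zeta * conj zeta)]. *)
Definition grad_x (s t : R) : R := 2 * s * / (1 - (s * s + t * t)).
Definition grad_y (s t : R) : R := 2 * t * / (1 - (s * s + t * t)).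

Lemma gauss_den_pos p q : 0 < gauss_den p q.
Proof. unfold gauss_den. generalize (sqrt_pos (1 + (p ^ 2 + q ^ 2))). lra. Qed.

Lemma gauss_den_sqr p q :
  gauss_den p q * gauss_den p q - 2 * gauss_den p q = p ^ 2 + q ^ 2.
Proof.
  unfold gauss_den. assert (H : 0 <= 1 + (p ^ 2 + q ^ 2)) by nra.
  generalize (sqrt_sqrt _ H). nra.
Qed.

Lemma unit_disc_den s t : unit_disc (s, t) -> 0 < 1 - (s * s + t * t).
Proof. unfold unit_disc; simpl. lra. Qed.

Lemma gauss_norm p q :
  1 - (p / gauss_den p q * (p / gauss_den p q) + q / gauss_den p q * (q / gauss_den p q))
  = 2 / gauss_den p q.
Proof.
  assert (G := gauss_den_pos p q). assert (E := gauss_den_sqr p q).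
  set (g := gauss_den p q) in *. apply Rmult_eq_reg_l with (g * g); [|nra].
  field_simplify; [|lra|lra]. lra.
Qed.

Lemma gauss_in_disc p q : unit_disc (p / gauss_den p q, q / gauss_den p q).
Proof.
  assert (G := gauss_den_pos p q). assert (E := gauss_norm p q).
  assert (0 < 2 / gauss_den p q) by (apply Rdiv_lt_0_compat; lra).
  unfold unit_disc; simpl. lra.
Qed.

Lemma grad_gauss p q :
  grad_x (p / gauss_den p q) (q / gauss_den p q) = p /\
  grad_y (p / gauss_den p q) (q / gauss_den p q) = q.
Proof.
  assert (G := gauss_den_pos p q).
  unfold grad_x, grad_y. rewrite gauss_norm. split; field; lra.
Qed.

Lemma gauss_grad s t : unit_disc (s, t) ->
  grad_x s t / gauss_den (grad_x s t) (grad_y s t) = s /\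
  grad_y s t / gauss_den (grad_x s t) (grad_y s t) = t.
Proof.
  intros H. assert (D := unit_disc_den s t H).
  assert (E : gauss_den (grad_x s t) (grad_y s t) = 2 / (1 - (s * s + t * t))).
  { unfold gauss_den.
    replace (1 + (grad_x s t ^ 2 + grad_y s t ^ 2)) with
      (((1 + (s * s + t * t)) / (1 - (s * s + t * t))) ^ 2)
      by (unfold grad_x, grad_y; field; lra).
    rewrite sqrt_pow2.
    - field; lra.
    - apply Rmult_le_pos; [nra|]. apply Rlt_le, Rinv_0_lt_compat, D. }
  rewrite E. unfold grad_x, grad_y. split; field; lra.
Qed.

Lemma d_zbar_real f x y :
  d_zbar (cplx f) x y = (/ 2 * pdx f x y, / 2 * pdy f x y).
Proof.
  unfold d_zbar, Cpdx, Cpdy.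
  assert (Ex : pdx (im_part (cplx f)) x y = 0) by apply (Derive_const 0).
  assert (Ey : pdy (im_part (cplx f)) x y = 0) by apply (Derive_const 0).
  rewrite Ex, Ey. change (re_part (cplx f)) with f.
  apply injective_projections; simpl; field.
Qed.

Lemma d_z_real f x y :
  d_z (cplx f) x y = (/ 2 * pdx f x y, - / 2 * pdy f x y).
Proof.
  unfold d_z, Cpdx, Cpdy.
  assert (Ex : pdx (im_part (cplx f)) x y = 0) by apply (Derive_const 0).
  assert (Ey : pdy (im_part (cplx f)) x y = 0) by apply (Derive_const 0).
  rewrite Ex, Ey. change (re_part (cplx f)) with f.
  apply injective_projections; simpl; field.
Qed.

(** The case [v = 0] of the definition is the one where the numerator
    [p + i q] of the rationalised form vanishes. *)
Lemma zeta_of_gradient phi x y :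
  zeta_of phi x y =
    (pdx phi x y / gauss_den (pdx phi x y) (pdy phi x y),
     pdy phi x y / gauss_den (pdx phi x y) (pdy phi x y)).
Proof.
  unfold zeta_of. rewrite d_zbar_real, d_z_real.
  set (p := pdx phi x y). set (q := pdy phi x y).
  assert (G := gauss_den_pos p q). assert (E := gauss_den_sqr p q).
  set (u := (/ 2 * p, / 2 * q) : C). set (v := (/ 2 * p, - / 2 * q) : C).
  destruct (Ceq_dec v 0%C) as [e|e].
  - assert (e1 := f_equal fst e). assert (e2 := f_equal snd e). simpl in e1, e2.
    replace p with 0 by lra. replace q with 0 by lra.
    unfold Rdiv. now rewrite !Rmult_0_l.
  - replace (1 + 4 * Re (u * v)%C)
      with (1 + (p ^ 2 + q ^ 2)) by (simpl; field).
    replace (sqrt (1 + (p ^ 2 + q ^ 2))) with (gauss_den p q - 1)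
      by (unfold gauss_den; ring).
    set (g := gauss_den p q) in *.
    assert (n0 : (2 * v <> 0)%C).
    { apply Cmult_neq_0; auto. intro F. apply (f_equal fst) in F. simpl in F. lra. }
    assert (M : (RtoC (g - 1)%R - 1 = ((p / g)%R, (q / g)%R) * (2 * v))%C).
    { apply injective_projections; simpl.
      - apply Rmult_eq_reg_l with g; [|lra]. field_simplify; [|lra]. nra.
      - field. lra. }
    rewrite M. unfold Cdiv. rewrite <- Cmult_assoc, Cinv_r, Cmult_1_r; auto.
Qed.

Lemma d_z_pair a b f x y : (forall u v, f u v = (a u v, b u v)) ->
  d_z f x y = (/ 2 * (pdx a x y + pdy b x y), / 2 * (pdx b x y - pdy a x y)).
Proof.
  intros H. unfold d_z, Cpdx, Cpdy.
  assert (E1 : pdx (re_part f) x y = pdx a x y)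
    by (apply Derive_ext; intros; unfold re_part; now rewrite H).
  assert (E2 : pdx (im_part f) x y = pdx b x y)
    by (apply Derive_ext; intros; unfold im_part; now rewrite H).
  assert (E3 : pdy (re_part f) x y = pdy a x y)
    by (apply Derive_ext; intros; unfold re_part; now rewrite H).
  assert (E4 : pdy (im_part f) x y = pdy b x y)
    by (apply Derive_ext; intros; unfold im_part; now rewrite H).
  rewrite E1, E2, E3, E4. apply injective_projections; simpl; field.
Qed.

Lemma d_zbar_pair a b f x y : (forall u v, f u v = (a u v, b u v)) ->
  d_zbar f x y = (/ 2 * (pdx a x y - pdy b x y), / 2 * (pdx b x y + pdy a x y)).
Proof.
  intros H. unfold d_zbar, Cpdx, Cpdy.
  assert (E1 : pdx (re_part f) x y = pdx a x y)
    by (apply Derive_ext; intros; unfold re_part; now rewrite H).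
  assert (E2 : pdx (im_part f) x y = pdx b x y)
    by (apply Derive_ext; intros; unfold im_part; now rewrite H).
  assert (E3 : pdy (re_part f) x y = pdy a x y)
    by (apply Derive_ext; intros; unfold re_part; now rewrite H).
  assert (E4 : pdy (im_part f) x y = pdy b x y)
    by (apply Derive_ext; intros; unfold im_part; now rewrite H).
  rewrite E1, E2, E3, E4. apply injective_projections; simpl; field.
Qed.

(** The expression that [non_umbilic] requires to be nonzero is [-1/4] times
    the Hessian determinant. *)
Lemma non_umbilic_hessian (U : R * R -> Prop) phi x y :
  open U -> smooth_on U phi -> U (x, y) -> non_umbilic phi x y ->
  jacobian (pdx phi) (pdy phi) x y <> 0.
Proof.
  intros oU sphi Uxy nu J0. apply nu.
  assert (sym := Ck_pd_comm U phi x y oU (fun u v H => sphi 2%nat u v H) Uxy).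
  rewrite (d_z_pair _ _ (d_z (cplx phi)) x y (d_z_real phi)).
  rewrite (d_zbar_pair _ _ (d_zbar (cplx phi)) x y (d_zbar_real phi)).
  rewrite (d_zbar_pair _ _ (d_z (cplx phi)) x y (d_z_real phi)).
  unfold jacobian in J0.
  assert (scx : forall c f, pdx (fun u v => c * f u v) x y = c * pdx f x y)
    by (intros; apply Derive_scal).
  assert (scy : forall c f, pdy (fun u v => c * f u v) x y = c * pdy f x y)
    by (intros; apply Derive_scal).
  rewrite !scx, !scy, sym in *.
  apply injective_projections; simpl; [|field].
  transitivity (- / 4 * (pdx (pdx phi) x y * pdy (pdy phi) x y
                         - pdy (pdx phi) x y * pdy (pdx phi) x y)); [field|].
  rewrite J0. ring.
Qed.

(** * The Weierstrass data in the coordinate zeta *)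

Lemma differentiable_grad s t : unit_disc (s, t) ->
  let D := 1 - (s * s + t * t) in
  differentiable_pt_lim grad_x s t
    (2 * (1 + s * s - t * t) / D ^ 2) (4 * s * t / D ^ 2) /\
  differentiable_pt_lim grad_y s t
    (4 * s * t / D ^ 2) (2 * (1 - s * s + t * t) / D ^ 2).
Proof.
  intros H D. assert (D0 : 0 < D) by now apply unit_disc_den.
  assert (dc : forall c, differentiable_pt_lim (fun _ _ => c) s t 0 0).
  { intros c. apply (differentiable_of_is_derive_x (fun _ => c)).
    apply @is_derive_const. }
  assert (d1 := differentiable_id1 s t). assert (d2 := differentiable_id2 s t).
  assert (dD := differentiable_plus _ _ _ _ _ _ _ _ (dc 1)
    (differentiable_mult _ _ _ _ _ _ _ _ (dc (-1))
      (differentiable_plus _ _ _ _ _ _ _ _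
        (differentiable_mult _ _ _ _ _ _ _ _ d1 d1)
        (differentiable_mult _ _ _ _ _ _ _ _ d2 d2)))).
  assert (dI : differentiable_pt_lim (fun s t => / (1 - (s * s + t * t))) s t
    (2 * s / D ^ 2) (2 * t / D ^ 2)).
  { apply differentiable_pt_lim_ext with
      (fun s t => / (1 + -1 * (s * s + t * t))).
    { apply locally_2d_forall; intros; f_equal; ring. }
    replace (2 * s / D ^ 2) with ((- 1 / D ^ 2) *
      (0 + (0 * (s * s + t * t) + -1 * (1 * s + s * 1 + (0 * t + t * 0)))))
      by (field; lra).
    replace (2 * t / D ^ 2) with ((- 1 / D ^ 2) *
      (0 + (0 * (s * s + t * t) + -1 * (0 * s + s * 0 + (1 * t + t * 1)))))
      by (field; lra).
    apply (differentiable_comp1 Rinv); [|exact dD].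
    replace (1 + -1 * (s * s + t * t)) with D by (unfold D; ring).
    apply (is_derive_inv (fun t => t)); [|lra]. apply @is_derive_id. }
  split.
  - replace (2 * (1 + s * s - t * t) / D ^ 2) with
      ((0 * s + 2 * 1) * / D + 2 * s * (2 * s / D ^ 2)) by (unfold D in *; field; lra).
    replace (4 * s * t / D ^ 2) with
      ((0 * s + 2 * 0) * / D + 2 * s * (2 * t / D ^ 2)) by (field; lra).
    apply (differentiable_mult (fun s _ => 2 * s)); [|exact dI].
    apply (differentiable_mult (fun _ _ => 2)); auto.
  - replace (2 * (1 - s * s + t * t) / D ^ 2) with
      ((0 * t + 2 * 1) * / D + 2 * t * (2 * t / D ^ 2)) by (unfold D in *; field; lra).
    replace (4 * s * t / D ^ 2) with
      ((0 * t + 2 * 0) * / D + 2 * t * (2 * s / D ^ 2)) by (field; lra).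
    apply (differentiable_mult (fun _ t => 2 * t)); [|exact dI].
    apply (differentiable_mult (fun _ _ => 2)); auto.
Qed.

(** The chain rule for [grad phi (x, y) = (grad_x, grad_y)] determines the
    derivatives of [x] and [y] by Cramer's rule, linearly in the cofactors of
    the Hessian.  The second and third claims then hold identically; the first
    and the last reduce to a multiple of the minimal surface equation, itself
    linear in the Hessian. *)
Lemma minimal_first_derivatives s t r m k xs xt ys yt :
  unit_disc (s, t) -> r * k - m * m <> 0 ->
  let D := 1 - (s * s + t * t) in
  (1 + grad_y s t ^ 2) * r - 2 * grad_x s t * grad_y s t * m
    + (1 + grad_x s t ^ 2) * k = 0 ->
  r * xs + m * ys = 2 * (1 + s * s - t * t) / D ^ 2 ->
  r * xt + m * yt = 4 * s * t / D ^ 2 ->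
  m * xs + k * ys = 4 * s * t / D ^ 2 ->
  m * xt + k * yt = 2 * (1 - s * s + t * t) / D ^ 2 ->
  let h1 := / 2 * (xs - yt) in
  let h2 := - / 2 * (xt + ys) in
  xs = (1 - s * s + t * t) * h1 + 2 * s * t * h2 /\
  xt = 2 * s * t * h1 - (1 - s * s + t * t) * h2 /\
  ys = - (2 * s * t * h1) - (1 + s * s - t * t) * h2 /\
  yt = 2 * s * t * h2 - (1 + s * s - t * t) * h1.
Proof.
  intros H J0 D mse E1 E2 E3 E4 h1 h2.
  assert (D0 : 0 < D) by now apply unit_disc_den.
  set (e := r * k - m * m) in *.
  assert (mse' : (D * D + 4 * t * t) * r - 8 * s * t * m + (D * D + 4 * s * s) * k = 0).
  { transitivity (D * D * 0); [|ring]. rewrite <- mse. unfold grad_x, grad_y.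
    fold D. field. lra. }
  assert (X1 : xs = 2 * (k * (1 + s * s - t * t) - 2 * s * t * m) / (e * D ^ 2)).
  { apply Rmult_eq_reg_l with e; auto.
    transitivity (k * (r * xs + m * ys) - m * (m * xs + k * ys)); [unfold e; ring|].
    rewrite E1, E3. field. split; lra. }
  assert (X2 : xt = 2 * (2 * s * t * k - m * (1 - s * s + t * t)) / (e * D ^ 2)).
  { apply Rmult_eq_reg_l with e; auto.
    transitivity (k * (r * xt + m * yt) - m * (m * xt + k * yt)); [unfold e; ring|].
    rewrite E2, E4. field. split; lra. }
  assert (Y1 : ys = 2 * (2 * s * t * r - m * (1 + s * s - t * t)) / (e * D ^ 2)).
  { apply Rmult_eq_reg_l with e; auto.
    transitivity (r * (m * xs + k * ys) - m * (r * xs + m * ys)); [unfold e; ring|].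
    rewrite E1, E3. field. split; lra. }
  assert (Y2 : yt = 2 * (r * (1 - s * s + t * t) - 2 * s * t * m) / (e * D ^ 2)).
  { apply Rmult_eq_reg_l with e; auto.
    transitivity (r * (m * xt + k * yt) - m * (r * xt + m * yt)); [unfold e; ring|].
    rewrite E2, E4. field. split; lra. }
  set (c := 2 / (e * D ^ 2)).
  assert (X1' : xs = c * (k * (1 + s * s - t * t) - 2 * s * t * m))
    by (rewrite X1; unfold c; field; lra).
  assert (X2' : xt = c * (2 * s * t * k - m * (1 - s * s + t * t)))
    by (rewrite X2; unfold c; field; lra).
  assert (Y1' : ys = c * (2 * s * t * r - m * (1 + s * s - t * t)))
    by (rewrite Y1; unfold c; field; lra).
  assert (Y2' : yt = c * (r * (1 - s * s + t * t) - 2 * s * t * m))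
    by (rewrite Y2; unfold c; field; lra).
  assert (mse_c : c / 2 * ((D * D + 4 * t * t) * r - 8 * s * t * m
                           + (D * D + 4 * s * s) * k) = 0) by (rewrite mse'; ring).
  clearbody c. unfold h1, h2. rewrite X1', X2', Y1', Y2'.
  split; [|split; [|split]]; apply Rminus_diag_uniq; try field;
    rewrite <- mse_c; unfold D; field.
Qed.

(** The real and imaginary parts of [1 - zeta^2] and [i (1 + zeta^2)] have this
    shape. *)
Definition quadratic (al be ga de s t : R) : R :=
  al + be * (s * s) + ga * (t * t) + de * (s * t).

Lemma differentiable_quadratic al be ga de s t :
  differentiable_pt_lim (quadratic al be ga de) s t
    (2 * be * s + de * t) (2 * ga * t + de * s).
Proof.
  assert (dc : forall c, differentiable_pt_lim (fun _ _ => c) s t 0 0).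
  { intros c. apply (differentiable_of_is_derive_x (fun _ => c)).
    apply @is_derive_const. }
  assert (d1 := differentiable_id1 s t). assert (d2 := differentiable_id2 s t).
  replace (2 * be * s + de * t) with
    (0 + (0 * (s * s) + be * (1 * s + s * 1)) + (0 * (t * t) + ga * (0 * t + t * 0))
       + (0 * (s * t) + de * (1 * t + s * 0))) by ring.
  replace (2 * ga * t + de * s) with
    (0 + (0 * (s * s) + be * (0 * s + s * 0)) + (0 * (t * t) + ga * (1 * t + t * 1))
       + (0 * (s * t) + de * (0 * t + s * 1))) by ring.
  unfold quadratic.
  apply (differentiable_plus (fun s t => al + be * (s * s) + ga * (t * t))
                             (fun s t => de * (s * t))).
  - apply (differentiable_plus (fun s t => al + be * (s * s)) (fun s t => ga * (t * t))).
    + apply (differentiable_plus (fun s t => al) (fun s t => be * (s * s))); auto.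
      apply (differentiable_mult (fun s t => be) (fun s t => s * s)); auto.
      apply (differentiable_mult (fun s t => s) (fun s t => s)); auto.
    + apply (differentiable_mult (fun s t => ga) (fun s t => t * t)); auto.
      apply (differentiable_mult (fun s t => t) (fun s t => t)); auto.
  - apply (differentiable_mult (fun s t => de) (fun s t => s * t)); auto.
    apply (differentiable_mult (fun s t => s) (fun s t => t)); auto.
Qed.

(** [h = h1 + i h2] is the Wirtinger derivative of [x - i y] with respect to
    [zeta = s + i t]; it will turn out to be [F']. *)
Definition weier1 (xs ys : R -> R -> R) (s t : R) : R :=
  / 2 * (pdx xs s t - pdy ys s t).
Definition weier2 (xs ys : R -> R -> R) (s t : R) : R :=
  - / 2 * (pdy xs s t + pdx ys s t).

(** [dx = Re ((1 - zeta^2) h dzeta)] and [dy = Re (i (1 + zeta^2) h dzeta)],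
    in real coordinates. *)
Definition weierstrass_form (W : R * R -> Prop) (xs ys : R -> R -> R) : Prop :=
  forall s t, W (s, t) ->
    let h1 := weier1 xs ys s t in
    let h2 := weier2 xs ys s t in
    pdx xs s t = (1 - s * s + t * t) * h1 + 2 * s * t * h2 /\
    pdy xs s t = 2 * s * t * h1 - (1 - s * s + t * t) * h2 /\
    pdx ys s t = - (2 * s * t * h1) - (1 + s * s - t * t) * h2 /\
    pdy ys s t = 2 * s * t * h2 - (1 + s * s - t * t) * h1.

(** Closedness of [dx] and [dy] says that [(1 - zeta^2) k] and
    [i (1 + zeta^2) k] are real, where [k] is the derivative of [h] with
    respect to the conjugate of [zeta].  These are two real linear
    equations for [k], of determinant [1 - |zeta|^4] up to sign, whence [k = 0] in the unit disc. *)
Lemma weierstrass_holomorphic W xs ys s t :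
  open W -> (forall q, W q -> unit_disc q) -> smooth_on W xs -> smooth_on W ys ->
  weierstrass_form W xs ys -> W (s, t) ->
  pdx (weier1 xs ys) s t = pdy (weier2 xs ys) s t /\
  pdy (weier1 xs ys) s t = - pdx (weier2 xs ys) s t.
Proof.
  intros oW Wdisc sx sy form Wst.
  assert (Cx : forall k, Ck k W xs) by (intros k u v; apply sx).
  assert (Cy : forall k, Ck k W ys) by (intros k u v; apply sy).
  assert (C1 : Ck 1 W (weier1 xs ys)).
  { apply Ck_mult; auto using Ck_const. apply Ck_minus; auto using Ck_pdx, Ck_pdy. }
  assert (C2 : Ck 1 W (weier2 xs ys)).
  { apply Ck_mult; auto using Ck_const. apply Ck_plus; auto using Ck_pdx, Ck_pdy. }
  assert (symx := Ck_pd_comm W xs s t oW (Cx 2%nat) Wst).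
  assert (symy := Ck_pd_comm W ys s t oW (Cy 2%nat) Wst).
  assert (D1 := Ck_differentiable 0 W _ s t oW C1 Wst).
  assert (D2 := Ck_differentiable 0 W _ s t oW C2 Wst).
  assert (comb : forall f al be ga de al' be' ga' de',
    (forall u v, W (u, v) -> f u v = quadratic al be ga de u v * weier1 xs ys u v
                             + quadratic al' be' ga' de' u v * weier2 xs ys u v) ->
    pdx f s t = (2 * be * s + de * t) * weier1 xs ys s t
                + quadratic al be ga de s t * pdx (weier1 xs ys) s t
                + ((2 * be' * s + de' * t) * weier2 xs ys s t
                   + quadratic al' be' ga' de' s t * pdx (weier2 xs ys) s t) /\
    pdy f s t = (2 * ga * t + de * s) * weier1 xs ys s t
                + quadratic al be ga de s t * pdy (weier1 xs ys) s t
                + ((2 * ga' * t + de' * s) * weier2 xs ys s t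
                   + quadratic al' be' ga' de' s t * pdy (weier2 xs ys) s t)).
  { intros f al be ga de al' be' ga' de' Hf. apply differentiable_pd.
    apply differentiable_pt_lim_ext with
      (fun u v => quadratic al be ga de u v * weier1 xs ys u v
                  + quadratic al' be' ga' de' u v * weier2 xs ys u v).
    { destruct (open_locally_2d W s t oW Wst) as [dl Hdl]. exists dl.
      intros u v Hu Hv. symmetry. now apply Hf, Hdl. }
    apply differentiable_plus; apply differentiable_mult; auto;
      apply differentiable_quadratic. }
  destruct (comb (pdx xs) 1 (-1) 1 0 0 0 0 2) as [_ Exy].
  { intros u v Wuv. destruct (form u v Wuv) as (E & _).
    rewrite E at 1. unfold quadratic. ring. }
  destruct (comb (pdy xs) 0 0 0 2 (-1) 1 (-1) 0) as [Eyx _].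
  { intros u v Wuv. destruct (form u v Wuv) as (_ & E & _).
    rewrite E at 1. unfold quadratic. ring. }
  destruct (comb (pdx ys) 0 0 0 (-2) (-1) (-1) 1 0) as [_ Fxy].
  { intros u v Wuv. destruct (form u v Wuv) as (_ & _ & E & _).
    rewrite E at 1. unfold quadratic. ring. }
  destruct (comb (pdy ys) (-1) (-1) 1 0 0 0 0 2) as [Fyx _].
  { intros u v Wuv. destruct (form u v Wuv) as (_ & _ & _ & E).
    rewrite E at 1. unfold quadratic. ring. }
  rewrite symx, Exy in Eyx. rewrite symy, Fxy in Fyx.
  assert (H := Wdisc _ Wst). unfold unit_disc in H; simpl in H.
  set (k1 := pdx (weier1 xs ys) s t - pdy (weier2 xs ys) s t).
  set (k2 := pdy (weier1 xs ys) s t + pdx (weier2 xs ys) s t).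
  assert (L1 : (1 - s * s + t * t) * k2 - 2 * s * t * k1 = 0).
  { unfold quadratic in *. unfold k1, k2. lra. }
  assert (L2 : (1 + s * s - t * t) * k1 - 2 * s * t * k2 = 0).
  { unfold quadratic in *. unfold k1, k2. lra. }
  assert (det0 : 1 - (s * s + t * t) * (s * s + t * t) <> 0) by nra.
  assert (Z1 : k1 = 0).
  { apply Rmult_eq_reg_l with (2 := det0). rewrite Rmult_0_r.
    transitivity ((1 - s * s + t * t) * ((1 + s * s - t * t) * k1 - 2 * s * t * k2)
      + 2 * s * t * ((1 - s * s + t * t) * k2 - 2 * s * t * k1)); [ring|].
    rewrite L1, L2. ring. }
  assert (Z2 : k2 = 0).
  { apply Rmult_eq_reg_l with (2 := det0). rewrite Rmult_0_r.
    transitivity ((1 + s * s - t * t) * ((1 - s * s + t * t) * k2 - 2 * s * t * k1)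
      + 2 * s * t * ((1 + s * s - t * t) * k1 - 2 * s * t * k2)); [ring|].
    rewrite L1, L2. ring. }
  unfold k1 in Z1. unfold k2 in Z2. lra.
Qed.

(** A holomorphic [h] has a primitive [F] on a square; then each of the three
    coordinates is a real function whose differential is the real part of the
    corresponding multiple of [F' dzeta]. *)
Lemma weierstrass_integrals W xs ys zs (s0 t0 : R) :
  open W -> (forall q, W q -> unit_disc q) -> smooth_on W xs -> smooth_on W ys ->
  weierstrass_form W xs ys ->
  (forall s t, W (s, t) -> differentiable_pt_lim zs s t
     (2 * s * weier1 xs ys s t - 2 * t * weier2 xs ys s t)
     (- (2 * s * weier2 xs ys s t + 2 * t * weier1 xs ys s t))) ->
  W (s0, t0) ->
  exists (r : R) (F : C -> C),
    0 < r /\ (forall w : C, cdisc (s0, t0) r w -> W w) /\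
    holomorphic_on (cdisc (s0, t0) r) F /\
    (forall w : C, cdisc (s0, t0) r w ->
      xs (Re w) (Im w) = xs s0 t0
        + Re (cint (fun om => (1 - om * om) * C_derive F om)%C (s0, t0) w) /\
      ys (Re w) (Im w) = ys s0 t0
        + Re (cint (fun om => Ci * (1 + om * om) * C_derive F om)%C (s0, t0) w) /\
      zs (Re w) (Im w) = zs s0 t0
        + Re (cint (fun om => 2 * om * C_derive F om)%C (s0, t0) w)).
Proof.
  intros oW Wdisc sx sy form Dz W0.
  destruct (open_locally_2d W s0 t0 oW W0) as [r Hr].
  set (B := square s0 t0 r).
  assert (BW : forall q, B q -> W q).
  { intros [s t] [Hs Ht]. now apply Hr. }
  assert (oB : open B) by apply open_square.
  set (h1 := weier1 xs ys) in *. set (h2 := weier2 xs ys) in *.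
  assert (Cx : forall k, Ck k W xs) by (intros k u v; apply sx).
  assert (Cy : forall k, Ck k W ys) by (intros k u v; apply sy).
  assert (C1 : Ck 1 B h1).
  { apply (Ck_sub 1 B W); auto.
    apply Ck_mult; auto using Ck_const. apply Ck_minus; auto using Ck_pdx, Ck_pdy. }
  assert (C2 : Ck 1 B h2).
  { apply (Ck_sub 1 B W); auto.
    apply Ck_mult; auto using Ck_const. apply Ck_plus; auto using Ck_pdx, Ck_pdy. }
  assert (CR : forall s t, B (s, t) ->
    pdx h1 s t = pdy h2 s t /\ pdy h1 s t = - pdx h2 s t).
  { intros s t Bst. apply (weierstrass_holomorphic W); auto. }
  destruct (poincare_square h1 (fun s t => - h2 s t) s0 t0 r) as [P HP]; auto.
  { now apply Ck_opp. }
  { intros s t Bst. rewrite (proj2 (CR s t Bst)). symmetry.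
    unfold pdx at 1. apply Derive_opp. }
  destruct (poincare_square h2 h1 s0 t0 r) as [Q HQ]; auto.
  { intros s t Bst. symmetry. apply (CR s t Bst). }
  set (F := complex_of P Q).
  assert (DF : forall s t, B (s, t) ->
    is_derive (K := C_AbsRing) (V := C_NormedModule) F (s, t) (h1 s t, h2 s t)).
  { intros s t Bst. apply cauchy_riemann; auto. }
  assert (CF : forall s t, B (s, t) -> C_derive F (s, t) = (h1 s t, h2 s t)).
  { intros s t Bst. apply is_C_derive_unique. now apply DF. }
  assert (discB : forall w, cdisc (s0, t0) r w -> B w).
  { intros w Hw. unfold cdisc in Hw.
    assert (M := Rmax_Cmod (w - (s0, t0))%C). destruct w as [s t]. simpl in M.
    split; simpl; apply Rle_lt_trans with (2 := Hw); apply Rle_trans with (2 := M).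
    - apply Rmax_l. - apply Rmax_r. }
  assert (B0 : B (s0, t0)).
  { split; simpl; rewrite Rminus_diag, Rabs_R0; apply cond_pos. }
  exists r, F. split; [apply cond_pos|]. split; [auto|]. split.
  { intros [s t] Hw. eexists. now apply DF, discB. }
  assert (C10 : Ck 0 B h1) by (apply (Ck_le 0 1); auto).
  assert (C20 : Ck 0 B h2) by (apply (Ck_le 0 1); auto).
  assert (I1 := Ck_id1 0 B oB). assert (I2 := Ck_id2 0 B oB).
  assert (Cc : forall c, Ck 0 B (fun _ _ => c)) by (intros; apply Ck_const).
  assert (lin : forall a b, Ck 0 B a -> Ck 0 B b ->
    Ck 0 B (fun s t => a s t * h1 s t + b s t * h2 s t)) by auto using Ck_plus, Ck_mult.
  assert (Cq : forall al be ga de, Ck 0 B (quadratic al be ga de)).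
  { intros. unfold quadratic. apply Ck_plus; auto using Ck_mult.
    apply Ck_plus; auto using Ck_mult. apply Ck_plus; auto using Ck_mult. }
  assert (Dx : forall s t, B (s, t) ->
    differentiable_pt_lim xs s t (pdx xs s t) (pdy xs s t)).
  { intros s t Bst. apply (Ck_differentiable 0 W); auto. }
  assert (Dy : forall s t, B (s, t) ->
    differentiable_pt_lim ys s t (pdx ys s t) (pdy ys s t)).
  { intros s t Bst. apply (Ck_differentiable 0 W); auto. }
  intros w Hw. apply discB in Hw. split; [|split].
  - rewrite (Re_cint_primitive xs
      (fun s t => quadratic 1 (-1) 1 0 s t * h1 s t + quadratic 0 0 0 2 s t * h2 s t)
      (fun s t => quadratic 0 0 0 (-2) s t * h1 s t + quadratic 1 (-1) 1 0 s t * h2 s t)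
      _ s0 t0 r); auto.
    + simpl. ring.
    + intros s t Bst. destruct (form s t (BW _ Bst)) as (E1 & E2 & _).
      fold h1 h2 in E1, E2.
      replace (quadratic 1 (-1) 1 0 s t * h1 s t + quadratic 0 0 0 2 s t * h2 s t)
        with (pdx xs s t) by (rewrite E1; unfold quadratic; ring).
      replace (- (quadratic 0 0 0 (-2) s t * h1 s t + quadratic 1 (-1) 1 0 s t * h2 s t))
        with (pdy xs s t) by (rewrite E2; unfold quadratic; ring).
      now apply Dx.
    + intros s t Bst. rewrite CF by exact Bst. unfold quadratic.
      apply injective_projections; simpl; ring.
  - rewrite (Re_cint_primitive ys
      (fun s t => quadratic 0 0 0 (-2) s t * h1 s t + quadratic (-1) (-1) 1 0 s t * h2 s t)
      (fun s t => quadratic 1 1 (-1) 0 s t * h1 s t + quadratic 0 0 0 (-2) s t * h2 s t)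
      _ s0 t0 r); auto.
    + simpl. ring.
    + intros s t Bst. destruct (form s t (BW _ Bst)) as (_ & _ & E1 & E2).
      fold h1 h2 in E1, E2.
      replace (quadratic 0 0 0 (-2) s t * h1 s t + quadratic (-1) (-1) 1 0 s t * h2 s t)
        with (pdx ys s t) by (rewrite E1; unfold quadratic; ring).
      replace (- (quadratic 1 1 (-1) 0 s t * h1 s t + quadratic 0 0 0 (-2) s t * h2 s t))
        with (pdy ys s t) by (rewrite E2; unfold quadratic; ring).
      now apply Dy.
    + intros s t Bst. rewrite CF by exact Bst. unfold quadratic.
      apply injective_projections; simpl; ring.
  - rewrite (Re_cint_primitive zs
      (fun s t => 2 * s * h1 s t + (-2 * t) * h2 s t)
      (fun s t => 2 * t * h1 s t + 2 * s * h2 s t)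
      _ s0 t0 r); auto.
    + simpl. ring.
    + intros s t Bst.
      replace (2 * s * h1 s t + (-2 * t) * h2 s t)
        with (2 * s * h1 s t - 2 * t * h2 s t) by ring.
      rewrite (Rplus_comm (2 * t * h1 s t)). auto.
    + apply (lin (fun s t => 2 * s) (fun s t => -2 * t)); auto using Ck_mult.
    + apply (lin (fun s t => 2 * t) (fun s t => 2 * s)); auto using Ck_mult.
    + intros s t Bst. rewrite CF by exact Bst.
      apply injective_projections; simpl; ring.
Qed.

(** * Minimal graphs in the coordinate zeta *)

(** The chart enters only through the identity [grad phi (xs, ys) =
    (grad_x, grad_y)], to which the chain rule is applied. *)
Lemma minimal_weierstrass_form (V W : R * R -> Prop) phi xs ys :
  open V -> smooth_on V phi ->
  (forall x y, V (x, y) -> minimal_surface_eq phi x y) ->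
  (forall x y, V (x, y) -> jacobian (pdx phi) (pdy phi) x y <> 0) ->
  open W -> (forall q, W q -> unit_disc q) -> smooth_on W xs -> smooth_on W ys ->
  (forall s t, W (s, t) -> V (xs s t, ys s t) /\
     pdx phi (xs s t) (ys s t) = grad_x s t /\
     pdy phi (xs s t) (ys s t) = grad_y s t) ->
  weierstrass_form W xs ys.
Proof.
  intros oV sphi mse J0 oW Wdisc sx sy chart s t Wst.
  destruct (chart s t Wst) as (Vxy & ex & ey).
  set (x := xs s t) in *. set (y := ys s t) in *.
  assert (Cphi : forall k, Ck k V phi) by (intros k u v; apply sphi).
  assert (Dxs : differentiable_pt_lim xs s t (pdx xs s t) (pdy xs s t))
    by (apply (Ck_differentiable 0 W); auto; intros u v; apply sx).
  assert (Dys : differentiable_pt_lim ys s t (pdx ys s t) (pdy ys s t))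
    by (apply (Ck_differentiable 0 W); auto; intros u v; apply sy).
  assert (Dp : differentiable_pt_lim (pdx phi) x y
                 (pdx (pdx phi) x y) (pdy (pdx phi) x y))
    by (apply (Ck_differentiable 0 V); auto using Ck_pdx).
  assert (Dq : differentiable_pt_lim (pdy phi) x y
                 (pdx (pdy phi) x y) (pdy (pdy phi) x y))
    by (apply (Ck_differentiable 0 V); auto using Ck_pdy).
  assert (sym := Ck_pd_comm V phi x y oV (Cphi 2%nat) Vxy).
  assert (chain_p := differentiable_pt_lim_comp _ _ _ _ _ _ _ _ _ _ _ Dp Dxs Dys).
  assert (chain_q := differentiable_pt_lim_comp _ _ _ _ _ _ _ _ _ _ _ Dq Dxs Dys).
  destruct (open_locally_2d W s t oW Wst) as [dl Hdl].
  apply differentiable_pt_lim_ext with (f2 := grad_x) in chain_p.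
  2:{ exists dl. intros u v Hu Hv. now apply chart, Hdl. }
  apply differentiable_pt_lim_ext with (f2 := grad_y) in chain_q.
  2:{ exists dl. intros u v Hu Hv. now apply chart, Hdl. }
  destruct (differentiable_grad s t (Wdisc _ Wst)) as [gp gq].
  apply differentiable_pd in chain_p, chain_q, gp, gq.
  destruct chain_p as [p1 p2], chain_q as [q1 q2], gp as [gp1 gp2], gq as [gq1 gq2].
  rewrite gp1 in p1. rewrite gp2 in p2. rewrite gq1, sym in q1. rewrite gq2, sym in q2.
  apply (minimal_first_derivatives s t (pdx (pdx phi) x y) (pdy (pdx phi) x y)
           (pdy (pdy phi) x y)); auto.
  - specialize (J0 x y Vxy). unfold jacobian in J0. rewrite sym in J0. exact J0.
  - specialize (mse x y Vxy). unfold minimal_surface_eq in mse.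
    rewrite ex, ey in mse. exact mse.
Qed.

(** [d phi = phi_x dx + phi_y dy] equals [Re (2 zeta h dzeta)] because
    [phi_x (1 - zeta^2) + phi_y i (1 + zeta^2) = 2 zeta]. *)
Lemma height_differentiable (V W : R * R -> Prop) phi xs ys s t :
  open V -> smooth_on V phi ->
  open W -> (forall q, W q -> unit_disc q) -> smooth_on W xs -> smooth_on W ys ->
  (forall s t, W (s, t) -> V (xs s t, ys s t) /\
     pdx phi (xs s t) (ys s t) = grad_x s t /\
     pdy phi (xs s t) (ys s t) = grad_y s t) ->
  weierstrass_form W xs ys -> W (s, t) ->
  differentiable_pt_lim (fun s t => phi (xs s t) (ys s t)) s t
    (2 * s * weier1 xs ys s t - 2 * t * weier2 xs ys s t)
    (- (2 * s * weier2 xs ys s t + 2 * t * weier1 xs ys s t)).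
Proof.
  intros oV sphi oW Wdisc sx sy chart form Wst.
  destruct (chart s t Wst) as (Vxy & ex & ey).
  destruct (form s t Wst) as (E1 & E2 & E3 & E4).
  assert (D0 := unit_disc_den s t (Wdisc _ Wst)).
  set (h1 := weier1 xs ys s t) in *. set (h2 := weier2 xs ys s t) in *.
  replace (2 * s * h1 - 2 * t * h2)
    with (grad_x s t * pdx xs s t + grad_y s t * pdx ys s t)
    by (rewrite E1, E3; unfold grad_x, grad_y; field; lra).
  replace (- (2 * s * h2 + 2 * t * h1))
    with (grad_x s t * pdy xs s t + grad_y s t * pdy ys s t)
    by (rewrite E2, E4; unfold grad_x, grad_y; field; lra).
  rewrite <- ex, <- ey. apply differentiable_pt_lim_comp.
  - apply (Ck_differentiable 0 V); auto. intros u v; apply sphi.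
  - apply (Ck_differentiable 0 W); auto. intros u v; apply sx.
  - apply (Ck_differentiable 0 W); auto. intros u v; apply sy.
Qed.

(** The inverse of [zeta] is the local inverse of [grad phi] composed with
    [(grad_x, grad_y)], a diffeomorphism of the unit disc onto the plane; no
    derivative of [zeta] itself has to be computed. *)
Lemma gauss_coordinate (U : R * R -> Prop) phi (x0 y0 : R) :
  open U -> smooth_on U phi -> U (x0, y0) ->
  jacobian (pdx phi) (pdy phi) x0 y0 <> 0 ->
  exists (V W : R * R -> Prop) (xs ys : R -> R -> R),
    V (x0, y0) /\ (forall q, V q -> U q) /\
    is_complex_coordinate V (zeta_of phi) W xs ys /\
    (forall x y, V (x, y) -> jacobian (pdx phi) (pdy phi) x y <> 0) /\
    (forall q, W q -> unit_disc q) /\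
    (forall s t, W (s, t) -> V (xs s t, ys s t) /\
       pdx phi (xs s t) (ys s t) = grad_x s t /\
       pdy phi (xs s t) (ys s t) = grad_y s t).
Proof.
  intros oU sphi U0 J0.
  assert (Cphi : forall k, Ck k U phi) by (intros k u v; apply sphi).
  destruct (inverse_function U (pdx phi) (pdy phi) x0 y0 oU)
    as (V & G & X & Y & oV & oG & V0 & VU & JV & sX & sY & VG & GV); auto.
  { intros n x y Uxy. now apply (Ck_pdx n U). }
  { intros n x y Uxy. now apply (Ck_pdy n U). }
  assert (oT : open (fun _ : R * R => True)) by apply open_true.
  assert (od : open unit_disc).
  { apply locally_2d_open. intros s t H. assert (D := unit_disc_den s t H).
    assert (C : Ck 0 (fun _ => True) (fun s t => 1 - (s * s + t * t))).
    { apply Ck_minus; auto using Ck_const.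
      apply Ck_plus; auto; apply Ck_mult; auto using Ck_id1, Ck_id2. }
    destruct (Ck_continuous 0 _ _ s t C I (mkposreal _ D)) as [dl Hdl].
    exists dl. intros u v Hu Hv. specialize (Hdl u v Hu Hv). simpl in Hdl.
    apply Rabs_def2 in Hdl. unfold unit_disc; simpl. lra. }
  assert (Cden : forall k, Ck k unit_disc (fun s t => / (1 - (s * s + t * t)))).
  { intros k. apply Ck_inv; auto.
    - intros s t H. generalize (unit_disc_den s t H). lra.
    - apply Ck_minus; auto using Ck_const.
      apply Ck_plus; auto; apply Ck_mult; auto using Ck_id1, Ck_id2. }
  assert (Cgx : forall k, Ck k unit_disc grad_x).
  { intros k. apply (Ck_mult k unit_disc (fun s _ => 2 * s)); auto.
    apply Ck_mult; auto using Ck_const, Ck_id1. }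
  assert (Cgy : forall k, Ck k unit_disc grad_y).
  { intros k. apply (Ck_mult k unit_disc (fun _ t => 2 * t)); auto.
    apply Ck_mult; auto using Ck_const, Ck_id2. }
  set (W := fun q : R * R => unit_disc q /\
              G (grad_x (fst q) (snd q), grad_y (fst q) (snd q))).
  assert (oW : open W) by (apply open_preimage; auto).
  assert (Wdisc : forall q, W q -> unit_disc q) by (intros q Hq; apply Hq).
  assert (Ccomp : forall f, smooth_on G f ->
    smooth_on W (fun s t => f (grad_x s t) (grad_y s t))).
  { intros f Hf k. apply (Ck_comp k W G); auto.
    - intros s t Wst. apply Wst.
    - intros u v. apply Hf.
    - apply (Ck_sub k W unit_disc); auto.
    - apply (Ck_sub k W unit_disc); auto. }
  assert (CpV : forall k, Ck k V (pdx phi)).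
  { intros k. apply (Ck_sub k V U); auto. now apply Ck_pdx. }
  assert (CqV : forall k, Ck k V (pdy phi)).
  { intros k. apply (Ck_sub k V U); auto. now apply Ck_pdy. }
  assert (CG : forall k,
    Ck k V (fun x y => / gauss_den (pdx phi x y) (pdy phi x y))).
  { intros k. apply Ck_inv; auto.
    - intros x y _. generalize (gauss_den_pos (pdx phi x y) (pdy phi x y)). lra.
    - apply Ck_plus; auto using Ck_const. apply Ck_sqrt; auto.
      + intros x y _. nra.
      + apply Ck_plus; auto using Ck_const. apply Ck_plus; auto;
          apply Ck_mult; auto; apply Ck_mult; auto using Ck_const. }
  exists V, W, (fun s t => X (grad_x s t) (grad_y s t)),
    (fun s t => Y (grad_x s t) (grad_y s t)).
  split; [exact V0|]. split; [exact VU|]. split; [|split; [exact JV|split; [exact Wdisc|]]].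
  - split; [exact oV|]. split; [exact oW|]. split; [|split; [|split; [|split; [|split]]]].
    + intros k. apply (Ck_ext k V (fun x y =>
        pdx phi x y * / gauss_den (pdx phi x y) (pdy phi x y))); auto using Ck_mult.
      intros x y _. unfold re_part. now rewrite zeta_of_gradient.
    + intros k. apply (Ck_ext k V (fun x y =>
        pdy phi x y * / gauss_den (pdx phi x y) (pdy phi x y))); auto using Ck_mult.
      intros x y _. unfold im_part. now rewrite zeta_of_gradient.
    + now apply Ccomp.
    + now apply Ccomp.
    + intros x y Vxy. rewrite zeta_of_gradient. unfold W. simpl.
      destruct (grad_gauss (pdx phi x y) (pdy phi x y)) as [e1 e2].
      rewrite e1, e2. destruct (VG x y Vxy) as (Gxy & eX & eY).
      split; [split; [apply gauss_in_disc|exact Gxy]|]. now split.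
    + intros s t [Dst Gst]; simpl in Gst. destruct (GV _ _ Gst) as (Vst & e1 & e2).
      split; [exact Vst|]. rewrite zeta_of_gradient, e1, e2.
      destruct (gauss_grad s t Dst) as [f1 f2]. now rewrite f1, f2.
  - intros s t [Dst Gst]; simpl in Gst. now apply GV.
Qed.

(** This is the identity [(1 - zeta^2)^2 + (i (1 + zeta^2))^2 + (2 zeta)^2 = 0]. *)
Lemma weierstrass_isothermal W xs ys zs :
  weierstrass_form W xs ys ->
  (forall s t, W (s, t) -> differentiable_pt_lim zs s t
     (2 * s * weier1 xs ys s t - 2 * t * weier2 xs ys s t)
     (- (2 * s * weier2 xs ys s t + 2 * t * weier1 xs ys s t))) ->
  isothermal_on W xs ys zs.
Proof.
  intros form Dz s t Wst. destruct (form s t Wst) as (E1 & E2 & E3 & E4).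
  destruct (differentiable_pd _ _ _ _ _ (Dz s t Wst)) as [E5 E6].
  simpl. rewrite E5, E6, E1, E2, E3, E4. split; ring.
Qed.

Theorem mainTheorem1 (phi : R -> R -> R) (U : R * R -> Prop) (x0 y0 : R)
  (U_open : open U)
  (phi_smooth : smooth_on U phi)
  (phi_minimal : forall x y : R, U (x, y) -> minimal_surface_eq phi x y)
  (p_in_U : U (x0, y0))
  (p_non_umbilic : non_umbilic phi x0 y0) :
  let zeta := zeta_of phi in
  let zeta0 := zeta x0 y0 in
  let phi0 := phi x0 y0 in
  exists (V : R * R -> Prop) (W : C -> Prop) (xs ys : R -> R -> R),
    let phis := fun s t : R => phi (xs s t) (ys s t) in
    V (x0, y0) /\
    (forall q : R * R, V q -> U q) /\
    is_complex_coordinate V zeta W xs ys /\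
    isothermal_on W xs ys phis /\
    exists (r : R) (F : C -> C),
      0 < r /\
      (forall w : C, cdisc zeta0 r w -> W w) /\
      holomorphic_on (cdisc zeta0 r) F /\
      (forall w : C, cdisc zeta0 r w ->
         xs (Re w) (Im w) =
           x0 + Re (cint (fun om => (1 - om * om) * C_derive F om)%C zeta0 w) /\
         ys (Re w) (Im w) =
           y0 + Re (cint (fun om => Ci * (1 + om * om) * C_derive F om)%C zeta0 w) /\
         phis (Re w) (Im w) =
           phi0 + Re (cint (fun om => 2 * om * C_derive F om)%C zeta0 w)).
Proof.
  intros zeta zeta0 phi0.
  assert (J0 := non_umbilic_hessian U phi x0 y0 U_open phi_smooth p_in_U p_non_umbilic).
  destruct (gauss_coordinate U phi x0 y0 U_open phi_smooth p_in_U J0)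
    as (V & W & xs & ys & V0 & VU & coord & JV & Wdisc & chart).
  exists V, W, xs, ys. intros phis.
  assert (sphi : smooth_on V phi) by (intros k x y Vxy; now apply phi_smooth, VU).
  assert (mse : forall x y, V (x, y) -> minimal_surface_eq phi x y) by auto.
  assert (coord' := coord). fold zeta in coord, coord'.
  destruct coord' as (oV & oW & _ & _ & sx & sy & VW & _).
  assert (form : weierstrass_form W xs ys)
    by now apply (minimal_weierstrass_form V W phi).
  assert (Dz := fun s t =>
    height_differentiable V W phi xs ys s t oV sphi oW Wdisc sx sy chart form).
  destruct (VW x0 y0 V0) as (W0 & ex & ey). fold zeta0 in W0, ex, ey.
  split; [exact V0|]. split; [exact VU|]. split; [exact coord|].
  split; [now apply weierstrass_isothermal|].
  assert (ez : phis (Re zeta0) (Im zeta0) = phi0)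
    by (unfold phis; now rewrite ex, ey).
  destruct zeta0 as [s0 t0].
  destruct (weierstrass_integrals W xs ys phis s0 t0 oW Wdisc sx sy form Dz W0)
    as (r & F & r0 & discW & holF & rep).
  simpl in ex, ey, ez. rewrite ex, ey, ez in rep.
  exists r, F. auto.
Qed.
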